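(* Exact-Unique-Reorder is solvable in $O(2^\ell n^{2\ell+2})$ time.
   Context: A Stable Marriage (SM) instance consists of a set $U$ of men and a set $W$ of women with $|U|=|W|=n$, and for every agent a strict total order (preference list) over all agents of the opposite gender. A matching is a set of man–woman pairs in which each agent appears at most once; it is complete if every agent is in a pair. A man–woman pair $\{m,w\}$ blocks a matching $M$ if ($m$ is unassigned or prefers $w$ to his partner in $M$) and ($w$ is unassigned or prefers $m$ to her partner in $M$); $M$ is stable if no pair blocks it. Reorder action: replace the preference list of one agent by an arbitrary strict total order over the same set of agents; costs one action. Exact-Unique-Reorder: given an SM instance, a complete matching $M^*$ and a budget $\ell$, decide whether one can reorder the preferences of at most $\ell$ agents such that $M^*$ is the unique stable matching of the altered instance. *)

(* Defs.v *)
From mathcomp Require Import all_boot all_fingroup.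
Set Implicit Arguments. Unset Strict Implicit. Unset Printing Implicit Defensive.

(* Men and women are both indexed by 'I_n.  The preference list of an agent
   is a strict total order over the n agents of the other gender, given as a
   permutation p : position -> agent (p 0 is the most preferred agent). *)
Record SMinst (n : nat) := SMInst {
  prefU : 'I_n -> {perm 'I_n};
  prefW : 'I_n -> {perm 'I_n}
}.

Section SM.
Variable n : nat.
Implicit Types (I : SMinst n) (M : {set 'I_n * 'I_n}).

Definition rank (p : {perm 'I_n}) (x : 'I_n) : nat := val ((p^-1)%g x).

Definition prefersU I (m w w' : 'I_n) : Prop :=
  rank (prefU I m) w < rank (prefU I m) w'.
Definition prefersW I (w m m' : 'I_n) : Prop :=
  rank (prefW I w) m < rank (prefW I w) m'.

Definition is_matching M : Prop :=
  forall p q, p \in M -> q \in M -> (p.1 = q.1 \/ p.2 = q.2) -> p = q.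

(* {m,w} blocks M: (m unassigned or prefers w to his partner) and
   (w unassigned or prefers m to her partner) *)
Definition blocks I M (m w : 'I_n) : Prop :=
  (forall w', (m, w') \in M -> prefersU I m w w') /\
  (forall m', (m', w) \in M -> prefersW I w m m').

Definition stable I M : Prop :=
  is_matching M /\ forall m w, ~ blocks I M m w.

Definition matching_of (mu : {perm 'I_n}) : {set 'I_n * 'I_n} :=
  [set (i, mu i) | i : 'I_n].

Definition unique_stable I M : Prop :=
  stable I M /\ forall M', stable I M' -> M' = M.

Definition num_reordered I I' : nat :=
  #|[set m | prefU I' m != prefU I m]| + #|[set w | prefW I' w != prefW I w]|.

Definition EUR I (mu : {perm 'I_n}) (l : nat) : Prop :=
  exists I' : SMinst n, num_reordered I I' <= l /\ unique_stable I' (matching_of mu).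

End SM.

(* A unit-cost RAM (while-language) over an unbounded memory nat -> nat with
   indirect addressing; operations: constants, load, +, truncated -,
   =, <, not, and.  No multiplication. *)
Definition memory := nat -> nat.

Inductive aexp :=
| ANum of nat
| ALoad of aexp
| AAdd of aexp & aexp
| ASub of aexp & aexp.

Inductive bexp :=
| BEq of aexp & aexp
| BLt of aexp & aexp
| BNot of bexp
| BAnd of bexp & bexp.

Inductive cmd :=
| CSkip
| CStore of aexp & aexp
| CSeq of cmd & cmd
| CIf of bexp & cmd & cmd
| CWhile of bexp & cmd.

Fixpoint aeval (m : memory) (a : aexp) : nat :=
  match a with
  | ANum k => k
  | ALoad a => m (aeval m a)
  | AAdd a b => aeval m a + aeval m b
  | ASub a b => aeval m a - aeval m b
  end.

Fixpoint beval (m : memory) (b : bexp) : bool :=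
  match b with
  | BEq a c => aeval m a == aeval m c
  | BLt a c => aeval m a < aeval m c
  | BNot b => ~~ beval m b
  | BAnd b c => beval m b && beval m c
  end.

Definition upd (m : memory) (a v : nat) : memory := fun x => if x == a then v else m x.

Inductive exec : cmd -> memory -> memory -> nat -> Prop :=
| ExSkip m : exec CSkip m m 1
| ExStore m a v : exec (CStore a v) m (upd m (aeval m a) (aeval m v)) 1
| ExSeq c1 c2 m m1 m2 t1 t2 :
    exec c1 m m1 t1 -> exec c2 m1 m2 t2 -> exec (CSeq c1 c2) m m2 (t1 + t2)
| ExIfT b c1 c2 m m' t :
    beval m b -> exec c1 m m' t -> exec (CIf b c1 c2) m m' t.+1
| ExIfF b c1 c2 m m' t :
    ~~ beval m b -> exec c2 m m' t -> exec (CIf b c1 c2) m m' t.+1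
| ExWhileF b c m : ~~ beval m b -> exec (CWhile b c) m m 1
| ExWhileT b c m m1 m2 t1 t2 :
    beval m b -> exec c m m1 t1 -> exec (CWhile b c) m1 m2 t2 ->
    exec (CWhile b c) m m2 (t1 + t2).+1.

Definition encode_seq (n : nat) (I : SMinst n) (mu : {perm 'I_n}) (l : nat) : seq nat :=
  [:: n; l] ++
  flatten [seq [seq val (prefU I i k) | k <- enum 'I_n] | i <- enum 'I_n] ++
  flatten [seq [seq val (prefW I i k) | k <- enum 'I_n] | i <- enum 'I_n] ++
  [seq val (mu i) | i <- enum 'I_n].

Definition encode (n : nat) (I : SMinst n) (mu : {perm 'I_n}) (l : nat) : memory :=
  fun a => nth 0 (encode_seq I mu l) a.

(* Main.v *)
Require Import Defs.
From mathcomp Require Import all_boot all_fingroup.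
From mathcomp Require Import zify.
Set Implicit Arguments. Unset Strict Implicit. Unset Printing Implicit Defensive.

(** Write node i for the pair (man i, woman mu i).  In an instance where mu is
    stable, let the successor of a man i be the first woman on his list that
    prefers him to her own partner.  A directed cycle of successors is a
    rotation, and exchanging partners along it gives another stable matching;
    conversely, the men that are worse off in another stable matching form a
    successor-closed set.  So mu is the unique stable matching iff it is stable
    and the successor graphs of the men and of the women are both acyclic.

    Assume that the reordered agents and, for each of them, its successor in the
    altered instance have been guessed: 2n * n choices for each reordered agent.
    A reordered woman can be made the successor of any man who ranks her below
    his own partner, by moving him above her partner, unless she has guessed him
    as her own successor.  What is left is a reachability question on each side:
    starting from the nodes that need no successor, can all nodes be connected
    along admissible successors?  A breadth-first search answers it in O(n^2)
    steps, since an admissible edge is recognized in constant time from the rank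
    tables once the first unavoidable candidate of each agent is known. *)

(** * Rotations and uniqueness *)

Section Rotations.
Variable n : nat.
Implicit Types (a b : 'I_n -> 'I_n -> nat) (N : rel 'I_n) (D : {set 'I_n}).

Definition rows_inj a := forall i, injective (a i).

(** [a i j] stands for the rank of woman mu j on the list of man i, and [b j i] for the rank of man
    i on hers. Naming each woman after her partner turns the target matching into the diagonal. *)
Definition diag_stable a b := forall i j, a i j < a i i -> b j i < b j j -> False.

(** Under [diag_stable] the minimum over all candidates automatically lies below the own partner on
    the list of i. *)
Definition succ a b (i j : 'I_n) :=
  b j i < b j j /\ forall k, b k i < b k k -> a i j <= a i k.

(** In a finite graph, a nonempty set whose nodes all have a successor inside it contains a cycle,
    and every cycle is such a set. This form avoids paths. *)
Definition acyclic (S : 'I_n -> 'I_n -> Prop) :=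
  forall D, (forall i, i \in D -> exists2 j, j \in D & S i j) -> D = set0.

Definition rel_stable a b N :=
  [/\ forall i j j', N i j -> N i j' -> j = j',
      forall i i' j, N i j -> N i' j -> i = i'
    & forall i j, (forall j', N i j' -> a i j < a i j') ->
                  (forall i', N i' j -> b j i < b j i') -> False].

Lemma rel_stable_swap a b N : rel_stable a b N -> rel_stable b a (fun j i => N i j).
Proof.
case=> H1 H2 H3; split=> [j i i'|j j' i|j i Hj Hi]; first exact: H2.
- exact: H1.
- exact: (H3 i j).
Qed.

Lemma diag_stable_swap a b : diag_stable a b -> diag_stable b a.
Proof. by move=> H i j Hb Ha; exact: (H j i). Qed.

Lemma succ_exists a b i k : b k i < b k k -> exists j, succ a b i j.
Proof.
move=> Hk; case: (@arg_minnP _ k (fun k => b k i < b k k) (a i) Hk) => j Hj Hmin.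
by exists j.
Qed.

Lemma acyclic_rank (S : 'I_n -> 'I_n -> Prop) (rho : 'I_n -> nat) :
  (forall i j, S i j -> rho j < rho i) -> acyclic S.
Proof.
move=> dec D HD; apply/eqP; apply: contraT => /set0Pn[i0 i0D].
case: (@arg_minnP _ i0 (mem D) rho i0D) => i iD Hmin.
by have [j jD /dec] := HD i iD; rewrite ltnNge Hmin.
Qed.

(** A man left single by [N] also counts as worse off. *)
Definition worse a N i := [forall j, N i j ==> (a i i < a i j)].

(** Every worse-off node has a successor that is worse off. Behind this, [N] permutes these nodes:
    the woman of a worse-off man must hold someone she strictly prefers, and stability of the
    diagonal makes him worse off too. *)
Lemma no_worse a b N i : rows_inj a -> rows_inj b -> diag_stable a b ->
  rel_stable a b N -> acyclic (succ a b) -> ~~ worse a N i.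
Proof.
move=> ia ib dst [N1 N2 Nst] acy.
pose D := [set i | worse a N i].
have worseE k j : N k j -> a k k < a k j -> k \in D.
  by move=> Nkj lt_kj; rewrite inE; apply/forallP=> j'; apply/implyP=> /(N1 _ _ _ Nkj) <-.
have noblock k j : (forall j', N k j' -> a k j < a k j') ->
    exists2 x, N x j & b j x <= b j k.
  move=> Ha; case: (pickP [pred x | N x j && (b j x <= b j k)]) => [x /andP[]|none].
    by exists x.
  case: (Nst k j Ha) => x Nx; rewrite ltnNge; apply/negP=> le.
  by have := none x; rewrite /= Nx le.
have step k : k \in D -> exists2 x, N x k & b k x < b k k.
  rewrite inE => /forallP wk.
  have [j' Nkj'|x Nx le] := noblock k k; first by have /implyP := wk j'; apply.
  exists x => //; rewrite ltn_neqAle le andbT; apply/eqP=> /ib exk.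
  by move: Nx; rewrite exk => Nkk; have := wk k; rewrite Nkk ltnn.
have pred_worse k x : N x k -> b k x < b k k -> x \in D.
  move=> Nx lt; apply: (worseE x k) => //.
  have := dst x k; case: (ltngtP (a x k) (a x x)) => // [_ /(_ isT lt) //|/ia exk].
  by rewrite exk ltnn in lt.
(* [phi k] is the partner of woman k under [N]. It maps the finite set [D] injectively into itself,
   hence onto itself. *)
pose phi k := odflt k [pick x | N x k].
have phiN k : k \in D -> N (phi k) k.
  by move/step=> [x Nx _]; rewrite /phi; case: pickP => [//|/(_ x)]; rewrite Nx.
have phiD : phi @: D = D.
  apply/eqP; rewrite eqEcard; apply/andP; split.
    apply/subsetP=> _ /imsetP[k kD ->]; have [x Nx lt] := step k kD.
    by rewrite (N2 _ _ _ (phiN k kD) Nx); exact: pred_worse lt.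
  rewrite card_in_imset // => k k' kD k'D e.
  by apply: N1 (phiN k kD) _; rewrite e; exact: phiN.
have D0 : D = set0.
  apply: acy => k kD; move: (kD); rewrite -{1}phiD => /imsetP[i' i'D ek].
  have Nki : N k i' by rewrite ek phiN.
  have cki : b i' k < b i' i'.
    by have [x Nx lt] := step i' i'D; rewrite (N2 _ _ _ Nki Nx).
  have [j [cj minj]] := succ_exists a cki; exists j; last by split.
  have [<-//|ji] := eqVneq i' j.
  have lt : a k j < a k i'.
    rewrite ltn_neqAle minj // andbT; apply/eqP=> /ia e.
    by rewrite e eqxx in ji.
  (* As k prefers j to his partner under [N], woman j holds some x she likes at least as much as k;
     then x is in [D], and so is j because [phi] permutes [D]. *)
  have [j' Nkj'|x Nx le] := noblock k j; first by rewrite -(N1 _ _ _ Nki Nkj').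
  have := pred_worse j x Nx (leq_ltn_trans le cj).
  rewrite -{1}phiD => /imsetP[z zD ex]; move: Nx; rewrite ex => Nx.
  by rewrite (N1 _ _ _ Nx (phiN z zD)).
by have := in_set0 i; rewrite -D0 inE => ->.
Qed.

(** When nobody on either side is worse off, an off-diagonal pair of [N] consists of two agents who
    both strictly gain, so it would block the diagonal. *)
Lemma only_diag a b N : rows_inj a -> rows_inj b -> diag_stable a b ->
  rel_stable a b N -> acyclic (succ a b) -> acyclic (succ b a) ->
  forall i j, N i j = (i == j).
Proof.
move=> ia ib dst Nst acu acw.
have U i := no_worse i ia ib dst Nst acu.
have W i := no_worse i ib ia (diag_stable_swap dst) (rel_stable_swap Nst) acw.
have [N1 N2 _] := Nst.
have Nii i : N i i.
  move: (U i); rewrite negb_forall => /existsP[j]; rewrite negb_imply -leqNgt => /andP[Nij le].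
  have [eij|ij] := eqVneq i j; first by rewrite {2}eij.
  move: (W j); rewrite negb_forall => /existsP[i']; rewrite negb_imply -leqNgt => /andP[Nij' le'].
  move: Nij' le' => /(N2 _ _ _ Nij) <- le'.
  case: (dst i j).
    by rewrite ltn_neqAle le andbT; apply/eqP=> /ia e; rewrite e eqxx in ij.
  by rewrite ltn_neqAle le' andbT; apply/eqP=> /ib e; rewrite e eqxx in ij.
move=> i j; apply/idP/eqP=> [Nij|<-//].
exact: N1 (Nii i) Nij.
Qed.

(* Eliminating the rotation carried by a minimal nonempty successor-closed set. *)
Lemma rotation_eliminated a b D : rows_inj a -> rows_inj b -> diag_stable a b ->
  D != set0 -> (forall i, i \in D -> exists2 j, j \in D & succ a b i j) ->
  exists2 N, rel_stable a b N & exists i, ~~ N i i.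
Proof.
move=> ia ib dst Dn0 HD.
pose cnd i j := b j i < b j j.
pose S i j := cnd i j && [forall k, cnd i k ==> (a i j <= a i k)].
have SP i j : reflect (succ a b i j) (S i j).
  apply: (iffP andP) => [[c /forallP m]|[c m]]; split=> //.
    by move=> k ck; have /implyP := m k; apply.
  by apply/forallP=> k; apply/implyP; exact: m.
pose closed (E : {set 'I_n}) := (E != set0) && [forall i in E, exists j in E, S i j].
have cD : closed D.
  rewrite /closed Dn0; apply/forall_inP=> i /HD[j jD /SP Sij].
  by apply/exists_inP; exists j.
have [C /minsetP[/andP[Cn0 /forall_inP HC] Cmin] _] := minset_exists cD.
pose s i := odflt i [pick j in C | S i j].
have sP i : i \in C -> s i \in C /\ S i (s i).
  move=> iC; rewrite /s; case: pickP => [j /andP[]//|none].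
  by have /exists_inP[j jC Sij] := HC i iC; have := none j; rewrite /= jC Sij.
(* The image of [C] under [s] is again closed, so minimality makes [s] a permutation of [C]. *)
have sC : s @: C = C.
  apply: Cmin; last by apply/subsetP=> _ /imsetP[i iC ->]; case: (sP i iC).
  apply/andP; split; first by case/set0Pn: Cn0 => i iC; apply/set0Pn; exists (s i); exact: imset_f.
  apply/forall_inP=> _ /imsetP[i iC ->]; have [siC _] := sP i iC.
  by apply/exists_inP; exists (s (s i)); [exact: imset_f|case: (sP _ siC)].
have s_inj : {in C &, injective s} by apply/imset_injP; rewrite sC.
pose N i j := if i \in C then j == s i else j == i.
have s_neq i : i \in C -> s i != i.
  by case/sP=> _ /andP[c _]; apply: contraL c => /eqP ->; rewrite /cnd ltnn.
exists N; last by case/set0Pn: Cn0 => i iC; exists i; rewrite /N iC eq_sym s_neq.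
(* No woman loses under [N]. So in a pair blocking [N] she prefers him to her diagonal partner,
   which is excluded by the choice of [s i] if i is in [C] and by [diag_stable] otherwise. *)
have Npre j : exists2 i', N i' j & b j i' <= b j j.
  have [jC|jC] := boolP (j \in C); last by exists j => //; rewrite /N (negPf jC).
  move: jC; rewrite -{1}sC => /imsetP[i' i'C ->]; exists i'; first by rewrite /N i'C.
  by case/sP: i'C => _ /andP[/ltnW].
split.
- by move=> i j j'; rewrite /N; case: ifP => _ /eqP -> /eqP ->.
- move=> i i' j; rewrite /N; case: ifP => iC; case: ifP => i'C /eqP -> /eqP.
  + exact: s_inj.
  + by move=> e; rewrite -e (proj1 (sP i iC)) in i'C.
  + by move=> e; rewrite e (proj1 (sP i' i'C)) in iC.
  + by [].
- move=> i j Ha Hb; have [i' Ni' le] := Npre j.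
  have {}Hb : b j i < b j j := leq_trans (Hb i' Ni') le.
  have [iC|iC] := boolP (i \in C).
    have := Ha (s i); rewrite /N iC eqxx => /(_ isT).
    have [_ /SP[_ m]] := sP i iC.
    by rewrite ltnNge m.
  by apply: (dst i j) Hb; apply: Ha; rewrite /N (negPf iC).
Qed.

Lemma unique_iff_acyclic a b : rows_inj a -> rows_inj b -> diag_stable a b ->
  (forall N, rel_stable a b N -> forall i j, N i j = (i == j)) <->
  acyclic (succ a b) /\ acyclic (succ b a).
Proof.
move=> ia ib dst; split=> [uniq|[acu acw] N Nst]; last exact: (only_diag ia ib dst Nst acu acw).
split=> D HD; apply/eqP; apply: contraT => Dn0.
  have [N /uniq NE [i]] := rotation_eliminated ia ib dst Dn0 HD.
  by rewrite NE eqxx.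
have [N /rel_stable_swap/uniq NE [i]] :=
  rotation_eliminated ib ia (diag_stable_swap dst) Dn0 HD.
by rewrite NE eqxx.
Qed.

End Rotations.

(** * Admissible successors of reordered agents *)

Section Modification.
Variable n : nat.
Implicit Types (a b : 'I_n -> 'I_n -> nat) (X Y : pred 'I_n) (gU gW : 'I_n -> nat).

(** Only women outside [Y] force i to have a successor: a woman in [Y] can be reordered so that she
    does not want him. *)
Definition sink b Y (i : 'I_n) := [forall k, ~~ Y k ==> ~~ (b k i < b k k)].

(* Whether j is an admissible successor of i.  A modified woman j may put any man
   above her partner, hence the disjunct [Y j]; only when i is modified too can
   this clash with what she wants, namely when her own guess is i. *)
Definition opt a b X Y gU gW (i j : 'I_n) : bool :=
  if X i then (gU i == j) && (if Y j then (j != i) && (gW j != i) else b j i < b j j)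
  else [&& a i i < a i j,
           [forall k, ~~ Y k && (b k i < b k k) ==> (a i j <= a i k)]
         & Y j || (b j i < b j j)].

(** No node is its own successor, so the value [g i = i] is free to encode that i has none. *)
Definition guess_ok a b (g : 'I_n -> nat) :=
  forall i j : 'I_n, (succ a b i j -> g i = j) /\ (g i = j -> i != j -> succ a b i j).

Lemma guess_exists a b : rows_inj a -> exists g : 'I_n -> 'I_n, guess_ok a b g.
Proof.
move=> ia.
pose S i j := (b j i < b j j) && [forall k, (b k i < b k k) ==> (a i j <= a i k)].
have SP i j : reflect (succ a b i j) (S i j).
  apply: (iffP andP) => [[c /forallP m]|[c m]]; split=> //.
    by move=> k ck; have /implyP := m k; apply.
  by apply/forallP=> k; apply/implyP; exact: m.
exists (fun i => odflt i [pick j | S i j]) => i j; case: pickP => [j' /SP Sij' | none] /=; split.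
- move=> Sij; congr val; apply: (ia i); apply/eqP; rewrite eqn_leq.
  by case: Sij Sij' => c m [c' m']; rewrite m // m'.
- by move=> /val_inj <-.
- by move/SP; rewrite none.
- by move=> /val_inj ->; rewrite eqxx.
Qed.

(** A certificate of failure when nonempty: admissible edges never leave [D], and [D] has no
    sink. *)
Definition unresolved (snk : pred 'I_n) (op : rel 'I_n) (D : {set 'I_n}) :=
  forall i, i \in D -> ~~ snk i /\ forall j, op i j -> j \in D.

(** A node that is not a sink has a candidate, hence a successor in the altered instance. That edge
    is admissible, so an unresolved set would violate acyclicity. *)
Lemma opt_complete a b a' b' X Y gU gW (D : {set 'I_n}) :
  rows_inj a' -> rows_inj b' ->
  (forall i, ~~ X i -> a' i =1 a i) -> (forall j, ~~ Y j -> b' j =1 b j) ->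
  diag_stable a' b' -> acyclic (succ a' b') ->
  (forall i j : 'I_n, X i -> succ a' b' i j -> gU i = j) ->
  (forall i j : 'I_n, Y i -> gW i = j -> i != j -> succ b' a' i j) ->
  unresolved (sink b Y) (opt a b X Y gU gW) D -> D = set0.
Proof.
move=> ia ib aE bE dst acy gUE gWE HD; apply: acy => i /HD[].
rewrite negb_forall => /existsP[k]; rewrite negb_imply negbK => /andP[Yk ck] HO.
have {ck} /succ_exists - /(_ a')[j Sij] : b' k i < b' k k by rewrite !bE.
exists j => //; apply: HO; case: (Sij) => cj minj.
have ij : j != i by apply: contraTN cj => /eqP ->; rewrite ltnn.
rewrite /opt; case: ifPn => Xi.
  rewrite (gUE _ _ Xi Sij) eqxx; case: ifPn => Yj; last by rewrite -!bE.
  (* If j in turn had guessed i, the two would prefer each other to their own partners and block the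
     diagonal. *)
  rewrite ij; apply/eqP=> e; have [c _] := gWE j i Yj e ij.
  exact: (dst i j).
apply/and3P; split.
- rewrite -!aE // ltn_neqAle; apply/andP; split.
    by apply/eqP=> /ia e; rewrite e eqxx in ij.
  by rewrite leqNgt; apply/negP=> lt; exact: (dst i j).
- apply/forallP=> k'; apply/implyP=> /andP[Yk' ck'].
  by rewrite -!aE // minj // !bE.
- by case: (boolP (Y j)) => //= Yj; rewrite -!bE.
Qed.

(* Where agent i of a modified side puts j: first everybody whose chosen
   successor is i, then the own partner, then the chosen successor. *)
Definition new_key (chosen_by picks : 'I_n -> option 'I_n) (i j : 'I_n) : nat :=
  if picks j == Some i then 0 else if j == i then 1
  else if chosen_by i == Some j then 2 else 3.

Definition good_pick (snk : pred 'I_n) (op : rel 'I_n) (rho : 'I_n -> nat)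
    (p : 'I_n -> option 'I_n) :=
  forall i, if p i is Some j then [/\ ~~ snk i, op i j & rho j < rho i] else snk i.

Lemma good_pick_exists (snk : pred 'I_n) (op : rel 'I_n) (rho : 'I_n -> nat) :
  (forall i, snk i \/ exists2 j, op i j & rho j < rho i) ->
  exists p, good_pick snk op rho p.
Proof.
move=> H; exists (fun i => if snk i then None else [pick j | op i j && (rho j < rho i)]).
move=> i; case: ifPn => // Ni; case: pickP => [j /andP[]//|none].
case: (H i) => [si|[j o r]]; first by rewrite si in Ni.
by have := none j; rewrite /= o r.
Qed.

Definition picks_setup a b a' X Y gU gW (pU pW : 'I_n -> option 'I_n) rU :=
  [/\ rows_inj a', good_pick (sink b Y) (opt a b X Y gU gW) rU pU,
      forall i, ~~ X i -> a' i =1 a i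
    & forall i, X i -> forall x y,
        new_key pU pW i x < new_key pU pW i y -> a' i x < a' i y].

Lemma opt_neq a b X Y gU gW i j : opt a b X Y gU gW i j -> i != j.
Proof.
apply: contraL => /eqP <-; rewrite /opt !ltnn (eqxx i) /=.
by case: ifP => // _; case: ifP => _; rewrite andbF.
Qed.

(** In [new_key] the own partner has key 1, and the only smaller key goes to the nodes that pick
    i. *)
Lemma above_self a b a' X Y gU gW pU pW rU i j :
  (forall j, pW j != Some j) ->
  picks_setup a b a' X Y gU gW pU pW rU -> X i -> (a' i j < a' i i) = (pW j == Some i).
Proof.
move=> nW [ia _ _ aK] Xi; have K := aK i Xi.
have kii : new_key pU pW i i = 1 by rewrite /new_key eqxx (negPf (nW i)).
case: eqP => [e|ne].
  by apply: K; rewrite kii /new_key e eqxx.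
apply/negP=> lt; have [ij|ij] := eqVneq j i; first by rewrite ij ltnn in lt.
have := K i j; rewrite kii /new_key (negPf ij); case: eqP => // _.
by case: eqP => _ /(_ isT); rewrite ltnNge ltnW.
Qed.

Lemma good_pick_neq a b X Y gU gW rU pU i :
  good_pick (sink b Y) (opt a b X Y gU gW) rU pU -> pU i != Some i.
Proof.
move=> /(_ i); case: (pU i) => [j [_ /opt_neq ij _]|//].
by apply: contra ij => /eqP[->].
Qed.

(** By [above_self], two modified agents block only if they pick each other, which [opt] forbids. If
    one is modified, the other picks it although an unmodified agent only picks below its own
    partner. If neither is, the pick of i lies below his partner and is no worse for him than the
    candidate j. *)
Lemma picks_stable a b a' b' X Y gU gW pU pW rU rW :
  picks_setup a b a' X Y gU gW pU pW rU -> picks_setup b a b' Y X gW gU pW pU rW ->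
  diag_stable a' b'.
Proof.
move=> SU SW i j; have [ia gU' aE _] := SU; have [ib gW' bE _] := SW.
have nU k := good_pick_neq k gU'; have nW k := good_pick_neq k gW'.
have aS := above_self _ nW SU; have bS := above_self _ nU SW.
have [Xi|Xi] := boolP (X i); have [Yj|Yj] := boolP (Y j).
- rewrite aS // bS // => /eqP pj /eqP pi.
  have := gU' i; rewrite pi /opt Xi Yj => -[_ /and3P[_ _ /negP]].
  have := gW' j; rewrite pj /opt Xi Yj => -[_ /and3P[/eqP -> _ _]] _ h _.
  by apply: h.
- rewrite aS // => /eqP pj; rewrite !bE // => lt.
  have := gW' j; rewrite pj /opt (negPf Yj) => -[_ /and3P[lt' _ _] _].
  by rewrite ltnNge ltnW in lt.
- rewrite bS // => + /eqP pi; rewrite !aE // => lt.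
  have := gU' i; rewrite pi /opt (negPf Xi) => -[_ /and3P[lt' _ _] _].
  by rewrite ltnNge ltnW in lt.
- rewrite !aE // !bE // => lt1 lt2; have := gU' i; case: (pU i) => [k|].
    rewrite /opt (negPf Xi) => -[_ /and3P[lt' /forallP/(_ j)/implyP + _] _].
    by rewrite Yj lt2 => /(_ isT); lia.
  by move/forallP/(_ j)/implyP/(_ Yj); rewrite lt2.
Qed.

(** The successor of i in the altered instance is his pick p. A modified candidate is one that i
    picked; any other one ranks no better than p, by [opt] if i is unmodified and by the keys 2 and
    3 if he is modified. *)
Lemma picks_rank a b a' b' X Y gU gW pU pW rU rW i j :
  picks_setup a b a' X Y gU gW pU pW rU -> picks_setup b a b' Y X gW gU pW pU rW ->
  succ a' b' i j -> rU j < rU i.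
Proof.
move=> SU SW [cj minj]; have dst := picks_stable SU SW.
have [ia gU' aE aK] := SU; have [ib gW' bE _] := SW.
have nU k := good_pick_neq k gU'; have nW k := good_pick_neq k gW'.
have bS := above_self _ nU SW.
have := gU' i; case pi : (pU i) => [p|]; last first.
  have [Yj|Yj] := boolP (Y j); first by move: cj; rewrite bS // pi.
  by move/forallP/(_ j)/implyP/(_ Yj); rewrite -!bE // cj.
case=> _ op rp; suff -> : j = p by [].
have cp : b' p i < b' p p.
  have [Yp|Yp] := boolP (Y p); first by rewrite bS // pi.
  move: op; rewrite /opt (negPf Yp) !bE //.
  by case: ifP => [_ /andP[]|_ /and3P[]].
apply: (ia i); apply/eqP; rewrite eqn_leq minj //=.
have [->//|jp] := eqVneq j p.
have [Xi|Xi] := boolP (X i).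
  have {}aK := aK i Xi; apply: ltnW; apply: aK.
  have jNi : j != i by apply: contraTneq cj => ->; rewrite ltnn.
  have pWj : pW j != Some i.
    by apply/eqP=> pWj; apply: (dst i j) cj; rewrite (above_self _ nW SU) // pWj.
  have -> : new_key pU pW i j = 3.
    by rewrite /new_key (negPf pWj) (negPf jNi) pi; case: eqP => // -[e]; rewrite e eqxx in jp.
  by rewrite /new_key pi eqxx; case: ifP => //; case: ifP.
rewrite !aE //; move: op; rewrite /opt (negPf Xi) => /and3P[_ /forallP m _].
have [Yj|Yj] := boolP (Y j); last first.
  by have /implyP := m j; apply; rewrite Yj -!bE.
by move: cj; rewrite bS // pi => /eqP[e]; rewrite e eqxx in jp.
Qed.

End Modification.

(** * From instances and matchings to rank functions *)

Section Instances.
Variables (n : nat) (mu : {perm 'I_n}).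
Implicit Types (I : SMinst n) (X Y : pred 'I_n).

Definition rkU I (i j : 'I_n) := rank (prefU I i) (mu j).
Definition rkW I (j i : 'I_n) := rank (prefW I (mu j)) i.

Lemma rank_inj (p : {perm 'I_n}) : injective (rank p).
Proof. by move=> x y /val_inj /perm_inj. Qed.

Lemma rkU_inj I : rows_inj (rkU I).
Proof. by move=> i j j' /rank_inj /perm_inj. Qed.

Lemma rkW_inj I : rows_inj (rkW I).
Proof. by move=> i j j' /rank_inj. Qed.

Lemma stableE I M :
  stable I M <-> rel_stable (rkU I) (rkW I) (fun i j => (i, mu j) \in M).
Proof.
split=> [[Mm Ms]|[M1 M2 Ms]].
  split=> [i j j' h h'|i i' j h h'|i j Ha Hb].
  - by have [/perm_inj] : (i, mu j) = (i, mu j') by apply: Mm => //; left.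
  - by have [] : (i, mu j) = (i', mu j) by apply: Mm => //; right.
  - apply: (Ms i (mu j)); split=> [w' h|m' /Hb //].
    by have := Ha (mu^-1 w')%g; rewrite /rkU permKV; apply.
split=> [[m w] [m' w'] h h' /= e|m w [Ha Hb]].
  case: e => e; move: h h'; rewrite -e.
    rewrite -(permKV mu w) -(permKV mu w') => h h'.
    by rewrite (M1 _ _ _ h h').
  by rewrite -(permKV mu w) => h h'; rewrite (M2 _ _ _ h h').
apply: (Ms m (mu^-1 w)%g) => [j'|i'].
  by rewrite /rkU permKV; exact: Ha.
by rewrite /rkW permKV; exact: Hb.
Qed.

Lemma in_matching_of (i j : 'I_n) : ((i, mu j) \in matching_of mu) = (i == j).
Proof.
apply/imsetP/eqP => [[k _ [-> /perm_inj ->]]//|->]; by exists j.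
Qed.

Lemma unique_stableE I : unique_stable I (matching_of mu) <->
  [/\ diag_stable (rkU I) (rkW I), acyclic (succ (rkU I) (rkW I))
    & acyclic (succ (rkW I) (rkU I))].
Proof.
have U := unique_iff_acyclic (@rkU_inj I) (@rkW_inj I).
have stM : stable I (matching_of mu) <-> diag_stable (rkU I) (rkW I).
  rewrite stableE; split=> [[_ _ H] i j Ha Hb|dst].
    by apply: (H i j) => k; rewrite in_matching_of => /eqP; [move=> <-|move=> ->].
  split=> [i j j'|i i' j|i j Ha Hb]; rewrite ?in_matching_of.
  - by move=> /eqP <- /eqP.
  - by move=> /eqP -> /eqP.
  - by apply: (dst i j); [apply: Ha|apply: Hb]; rewrite in_matching_of.
split=> [[/stM dst un]|[dst acu acw]].
  suff [] : acyclic (succ (rkU I) (rkW I)) /\ acyclic (succ (rkW I) (rkU I)) by split.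
  apply/(U dst) => N Nst i j.
  pose M := [set p : 'I_n * 'I_n | N p.1 (mu^-1 p.2)%g].
  have ME k k' : ((k, mu k') \in M) = N k k' by rewrite inE /= permK.
  have /un MM : stable I M.
    apply/stableE; case: Nst => N1 N2 N3; split=> [k k' k2|k k' k2|k k' Ha Hb].
    - by rewrite !ME; exact: N1.
    - by rewrite !ME; exact: N2.
    - by apply: (N3 k k') => z Nz; [apply: Ha|apply: Hb]; rewrite ME.
  by rewrite -ME MM in_matching_of.
split; first exact/stM.
move=> M /stableE Mst; apply/setP=> -[m w]; rewrite -(permKV mu w) in_matching_of.
by have [_ H] := U dst; exact: (H (conj acu acw) _ Mst m).
Qed.

(** Ties are broken by the index, and the position of an element is the number of elements before
    it. *)
Lemma perm_by_key (key : 'I_n -> nat) :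
  exists p : {perm 'I_n}, forall x y, key x < key y -> rank p x < rank p y.
Proof.
pose pre (y x : 'I_n) := (key y < key x) || ((key y == key x) && (y < x)).
pose below x := [set y | pre y x].
have below_lt x y : pre x y -> #|below x| < #|below y|.
  move=> xy; apply: proper_card; apply/properP; split.
    by apply/subsetP=> z; rewrite !inE; move: xy; rewrite /pre; lia.
  by exists x; rewrite !inE // /pre; lia.
have below_n x : #|below x| < n.
  rewrite -[X in _ < X]card_ord -cardsT; apply: proper_card; apply/properP; split=> //.
  by exists x; rewrite // inE /pre; lia.
pose f x := Ordinal (below_n x).
have f_inj : injective f.
  move=> x y /(congr1 val) /= e; apply/eqP/negPn/negP => xy.
  have /orP[] : pre x y || pre y x.
    by move: xy; rewrite -val_eqE /pre /=; lia.
  - by move/below_lt; rewrite e ltnn.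
  - by move/below_lt; rewrite e ltnn.
exists ((perm f_inj)^-1)%g => x y lt; rewrite /rank invgK !permE /=.
by apply: below_lt; rewrite /pre lt.
Qed.

(** The ranks choose a successor for every node that is not a sink, and the lists of the modified
    agents are then sorted by [new_key]. *)
Lemma EUR_sound I l X Y gU gW (rU rW : 'I_n -> nat) : #|X| + #|Y| <= l ->
  (forall i, sink (rkW I) Y i \/
     exists2 j, opt (rkU I) (rkW I) X Y gU gW i j & rU j < rU i) ->
  (forall i, sink (rkU I) X i \/
     exists2 j, opt (rkW I) (rkU I) Y X gW gU i j & rW j < rW i) ->
  EUR I mu l.
Proof.
move=> card_l /good_pick_exists[pU gpU] /good_pick_exists[pW gpW].
have exU i : exists p : {perm 'I_n}, if X i then forall x y,
    new_key pU pW i x < new_key pU pW i y -> rank p (mu x) < rank p (mu y)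
    else p = prefU I i.
  case: (X i); last by exists (prefU I i).
  have [p pP] := perm_by_key (fun w => new_key pU pW i (mu^-1 w)%g).
  by exists p => x y lt; apply: pP; rewrite !permK.
have exW j : exists p : {perm 'I_n}, if Y (mu^-1 j)%g then forall x y,
    new_key pW pU (mu^-1 j)%g x < new_key pW pU (mu^-1 j)%g y -> rank p x < rank p y
    else p = prefW I j.
  case: (Y _); last by exists (prefW I j).
  by have [p pP] := perm_by_key (new_key pW pU (mu^-1 j)%g); exists p.
have [fU fUP] := fin_all_exists exU; have [fW fWP] := fin_all_exists exW.
pose I' := SMInst fU fW; exists I'.
have SU : picks_setup (rkU I) (rkW I) (rkU I') X Y gU gW pU pW rU.
  split=> //; first exact: rkU_inj.
    by move=> i Xi j; have := fUP i; rewrite /rkU /= (negPf Xi) => ->.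
  by move=> i Xi; have := fUP i; rewrite Xi.
have SW : picks_setup (rkW I) (rkU I) (rkW I') Y X gW gU pW pU rW.
  split=> //; first exact: rkW_inj.
    by move=> j Yj i; have := fWP (mu j); rewrite /rkW /= permK (negPf Yj) => ->.
  by move=> j Yj; have := fWP (mu j); rewrite permK Yj.
split.
  apply: leq_trans card_l; apply: leq_add.
    apply: subset_leq_card; apply/subsetP=> i; rewrite inE /= unfold_in.
    by have := fUP i; case: (X i) => // ->; rewrite eqxx.
  rewrite -(card_imset Y (@perm_inj _ mu)); apply: subset_leq_card.
  apply/subsetP=> w; rewrite inE /=; have := fWP w.
  case: (boolP (Y _)) => [Yw _ _|_ ->]; last by rewrite eqxx.
  by apply/imsetP; exists (mu^-1 w)%g; rewrite ?permKV.
apply/unique_stableE; split; first exact: picks_stable SU SW.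
- by apply: (acyclic_rank (rho := rU)) => i j; exact: picks_rank SU SW.
- by apply: (acyclic_rank (rho := rW)) => i j; exact: picks_rank SW SU.
Qed.

(** Supersets of the reordered agents are covered because an enumerated guess always has l entries,
    some of which may be padding. [hU] and [hW] give a guess for every agent, reordered or not. *)
Lemma EUR_complete I l : EUR I mu l ->
  exists (X Y : {set 'I_n}) (hU hW : 'I_n -> 'I_n), #|X| + #|Y| <= l /\
  forall (X' Y' : pred 'I_n) (gU gW : 'I_n -> nat),
    {subset X <= X'} -> {subset Y <= Y'} ->
    (forall i, X' i -> gU i = hU i) -> (forall i, Y' i -> gW i = hW i) ->
  (forall D, unresolved (sink (rkW I) Y') (opt (rkU I) (rkW I) X' Y' gU gW) D -> D = set0) /\
  (forall D, unresolved (sink (rkU I) X') (opt (rkW I) (rkU I) Y' X' gW gU) D -> D = set0).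
Proof.
case=> I' [cardl /unique_stableE[dst acu acw]].
have [hU okU] := guess_exists (rkW I') (@rkU_inj I').
have [hW okW] := guess_exists (rkU I') (@rkW_inj I').
exists [set i | prefU I' i != prefU I i], [set j | prefW I' (mu j) != prefW I (mu j)], hU, hW.
split.
  apply: leq_trans cardl; rewrite leq_add2l -(card_imset _ (@perm_inj _ mu)).
  apply: subset_leq_card; apply/subsetP=> _ /imsetP[j + ->].
  by rewrite !inE.
move=> X' Y' gU gW sX sY gUE gWE.
have aE i : ~~ X' i -> rkU I' i =1 rkU I i.
  move=> Xi j; rewrite /rkU; suff /eqP -> : prefU I' i == prefU I i by [].
  by apply: contraNT Xi => ne; apply: sX; rewrite inE.
have bE j : ~~ Y' j -> rkW I' j =1 rkW I j.
  move=> Yj i; rewrite /rkW; suff /eqP -> : prefW I' (mu j) == prefW I (mu j) by [].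
  by apply: contraNT Yj => ne; apply: sY; rewrite inE.
split=> D.
  apply: (opt_complete (@rkU_inj I') (@rkW_inj I') aE bE dst acu).
    by move=> i j Xi Sij; rewrite gUE //; have [-> //] := okU i j.
  by move=> i j Yi; rewrite gWE // => e; have [_] := okW i j; apply.
apply: (opt_complete (@rkW_inj I') (@rkU_inj I') bE aE (diag_stable_swap dst) acw).
  by move=> i j Xi Sij; rewrite gWE //; have [-> //] := okW i j.
by move=> i j Yi; rewrite gUE // => e; have [_] := okU i j; apply.
Qed.

(** Capping the budget at the number of agents keeps every loop over the guessed agents linear in
    n. *)
Lemma EUR_minn I l : EUR I mu l <-> EUR I mu (minn l (n + n)).
Proof.
split=> -[I' [le uq]]; exists I'; split=> //; last by apply: leq_trans le (geq_minl _ _).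
rewrite leq_min le /=; apply: leq_add; rewrite -[X in _ <= X]card_ord; exact: max_card.
Qed.

End Instances.

(** * A calculus of timed programs over named arrays *)

Inductive arr :=
| vN | vNN | vMM | vL | vI | vK | vJ | vACC | vX | vSO | vOO | vTL | vFP | vOK | vFOUND | vDONE
| aOFF | aMI | aMU | aRK | aTA | aTG | aDG | aMD | aGS | aRES | aQU | aFST.

Definition arr_id (A : arr) : nat :=
  match A with
  | vN => 0 | vNN => 1 | vMM => 2 | vL => 3 | vI => 4 | vK => 5 | vJ => 6 | vACC => 7
  | vX => 8 | vSO => 9 | vOO => 10 | vTL => 11 | vFP => 12 | vOK => 13 | vFOUND => 14
  | vDONE => 15 | aOFF => 16 | aMI => 17 | aMU => 18 | aRK => 19 | aTA => 20 | aTG => 21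
  | aDG => 22 | aMD => 23 | aGS => 24 | aRES => 25 | aQU => 26 | aFST => 27
  end.

Lemma arr_id_inj : injective arr_id.
Proof. by do 2!case. Qed.

Definition state := arr -> nat -> nat.

Definition set (s : state) (A : arr) (i v : nat) : state :=
  fun A' i' => if (arr_id A' == arr_id A) && (i' == i) then v else s A' i'.

Inductive hexp :=
| HNum of nat
| HGet of arr & hexp
| HAdd of hexp & hexp
| HSub of hexp & hexp.

Inductive hbexp :=
| HEq of hexp & hexp
| HLt of hexp & hexp
| HNot of hbexp
| HAnd of hbexp & hbexp.

Fixpoint hev (s : state) (e : hexp) : nat :=
  match e with
  | HNum k => k
  | HGet A e => s A (hev s e)
  | HAdd e f => hev s e + hev s f
  | HSub e f => hev s e - hev s f
  end.

Fixpoint hbev (s : state) (b : hbexp) : bool :=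
  match b with
  | HEq e f => hev s e == hev s f
  | HLt e f => hev s e < hev s f
  | HNot b => ~~ hbev s b
  | HAnd b c => hbev s b && hbev s c
  end.

Definition double_exp (a : aexp) : aexp := AAdd a a.

(* Cell [a] of the array [A] lives at address [P + 32 a + arr_id A], where the
   base [P] is kept in cell 1; interleaving the arrays means that no array ever
   overflows into another one. *)
Definition address (A : arr) (a : aexp) : aexp :=
  AAdd (ALoad (ANum 1)) (AAdd (iter 5 double_exp a) (ANum (arr_id A))).

Fixpoint compile (e : hexp) : aexp :=
  match e with
  | HNum k => ANum k
  | HGet A e => ALoad (address A (compile e))
  | HAdd e f => AAdd (compile e) (compile f)
  | HSub e f => ASub (compile e) (compile f)
  end.

Fixpoint bcompile (b : hbexp) : bexp :=
  match b with
  | HEq e f => BEq (compile e) (compile f)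
  | HLt e f => BLt (compile e) (compile f)
  | HNot b => BNot (bcompile b)
  | HAnd b c => BAnd (bcompile b) (bcompile c)
  end.

Definition store (d : hexp) (v : aexp) : cmd :=
  if d is HGet A e then CStore (address A (compile e)) v else CSkip.
Definition Put d f : cmd := store d (compile f).
Definition Read d f : cmd := store d (ALoad (compile f)).
Definition If b c d : cmd := CIf (bcompile b) c d.
Definition While b c : cmd := CWhile (bcompile b) c.

Arguments Put : simpl never.
Arguments Read : simpl never.
Arguments If : simpl never.
Arguments While : simpl never.

Declare Scope prog_scope.
Delimit Scope prog_scope with prog.
Bind Scope prog_scope with hexp.
Bind Scope prog_scope with hbexp.
#[local] Coercion HNum : nat >-> hexp.
Local Notation "A .@ e" := (HGet A e) (at level 2, e at level 1) : prog_scope.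
Local Notation "! A" := (HGet A (HNum 0)) (at level 2) : prog_scope.
Local Notation "e + f" := (HAdd e f) : prog_scope.
Local Notation "e - f" := (HSub e f) : prog_scope.
Local Notation "e =? f" := (HEq e f) (at level 70) : prog_scope.
Local Notation "e <? f" := (HLt e f) (at level 70) : prog_scope.
Local Notation "~? b" := (HNot b) (at level 35, right associativity) : prog_scope.
Local Notation "b &? c" := (HAnd b c) (at level 75, right associativity) : prog_scope.
Local Notation "b |? c" := (HNot (HAnd (HNot b) (HNot c))) (at level 76, right associativity) : prog_scope.
Local Notation "d ::= f" := (Put d%prog f%prog) (at level 80, f at level 70).
Local Notation "c ;; d" := (CSeq c d) (at level 90, right associativity).

Definition For (A : arr) (e : hexp) (c : cmd) : cmd :=
  !A ::= 0 ;; While (!A <? e) (c ;; !A ::= !A + 1).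

Lemma aeval_address m A a : aeval m (address A a) = m 1 + (32 * aeval m a + arr_id A).
Proof. rewrite /address /=; lia. Qed.

(** * Total correctness with time bounds *)

Section Runs.
Variables (P : nat) (low : memory).

(** Below [P] the memory stays frozen to the input [low], whose cell 1 holds [P] itself; the arrays
    live from [P] on. *)
Definition rep (m : memory) (s : state) : Prop :=
  [/\ 1 < P, low 1 = P, forall a, a < P -> m a = low a
    & forall A i, m (P + (32 * i + arr_id A)) = s A i].

Lemma compileE m s e : rep m s -> aeval m (compile e) = hev s e.
Proof.
case=> P1 low1 rl ra; elim: e => //= [A e <-|e <- f <-|e <- f <-] //.
rewrite -ra -[in RHS]low1 -rl //; congr m; lia.
Qed.

Lemma bcompileE m s b : rep m s -> beval m (bcompile b) = hbev s b.
Proof.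
move=> r; elim: b => //= [e f|e f|b ->|b -> c ->] //; by rewrite !(compileE _ r).
Qed.

Definition run (c : cmd) (s : state) (T : nat) (Q : state -> Prop) : Prop :=
  forall m, rep m s -> exists m' t s', [/\ exec c m m' t, t <= T, rep m' s' & Q s'].

Lemma run_le T0 c s T Q : run c s T0 Q -> T0 <= T -> run c s T Q.
Proof.
move=> H le m /H[m' [t [s' [ex tT r q]]]]; exists m', t, s'; split=> //.
exact: leq_trans le.
Qed.

Lemma run_imp (Q0 : state -> Prop) c s T (Q : state -> Prop) :
  run c s T Q0 -> (forall s', Q0 s' -> Q s') -> run c s T Q.
Proof.
move=> H le m /H[m' [t [s' [ex tT r q]]]]; exists m', t, s'; split=> //; exact: le.
Qed.

Lemma run_skip s (Q : state -> Prop) : Q s -> run CSkip s 1 Q.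
Proof. by move=> q m r; exists m, 1, s; split=> //; constructor. Qed.

Lemma rep_upd m s A i v : rep m s ->
  rep (upd m (P + (32 * i + arr_id A)) v) (set s A i v).
Proof.
case=> P1 low1 rl ra; split=> // [a aP|A' i']; rewrite /upd.
  by rewrite ifN ?rl //; apply/eqP; lia.
have idlt B : arr_id B < 32 by case: B.
rewrite ra /set; have := idlt A; have := idlt A'.
by do 2!case: ifP => //; lia.
Qed.

Lemma run_put s A e f (Q : state -> Prop) :
  Q (set s A (hev s e) (hev s f)) -> run (Put (HGet A e) f) s 1 Q.
Proof.
move=> q m r; eexists; exists 1; eexists; split; [exact: ExStore|by []| |exact: q].
rewrite aeval_address !(compileE _ r); case: (r) => P1 low1 rl _.
by rewrite rl // low1; exact: rep_upd.
Qed.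

Lemma run_read s A e f (Q : state -> Prop) : hev s f < P ->
  Q (set s A (hev s e) (low (hev s f))) -> run (Read (HGet A e) f) s 1 Q.
Proof.
move=> fP q m r; eexists; exists 1; eexists; split; [exact: ExStore|by []| |exact: q].
rewrite aeval_address /= !(compileE _ r); case: (r) => P1 low1 rl _.
by rewrite !rl // low1; exact: rep_upd.
Qed.

Lemma run_seq c d s T1 T2 Q :
  run c s T1 (fun s' => run d s' T2 Q) -> run (c ;; d) s (T1 + T2) Q.
Proof.
move=> H m /H[m1 [t1 [s1 [ex1 le1 r1 /(_ _ r1)[m2 [t2 [s2 [ex2 le2 r2 q]]]]]]]].
exists m2, (t1 + t2), s2; split=> //; first exact: ExSeq ex1 ex2.
exact: leq_add.
Qed.

Lemma run_if b c d s T1 T2 Q : (hbev s b -> run c s T1 Q) ->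
  (~~ hbev s b -> run d s T2 Q) -> run (If b c d) s (T1 + T2).+1 Q.
Proof.
move=> H1 H2 m r; have [hb|hb] := boolP (hbev s b).
  have [m' [t [s' [ex le r' q]]]] := H1 hb m r; exists m', t.+1, s'; split=> //; last lia.
  by apply: ExIfT => //; rewrite (bcompileE _ r).
have [m' [t [s' [ex le r' q]]]] := H2 hb m r; exists m', t.+1, s'; split=> //; last lia.
by apply: ExIfF => //; rewrite (bcompileE _ r).
Qed.

Lemma run_while (Inv : nat -> state -> Prop) b c T :
  (forall k s, Inv k.+1 s -> hbev s b /\ run c s T (Inv k)) ->
  (forall s, Inv 0 s -> ~~ hbev s b) ->
  forall k s, Inv k s -> run (While b c) s (k * T.+1).+1 (Inv 0).
Proof.
move=> Hs H0; elim=> [|k IH] s Is m r.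
  exists m, 1, s; split=> //; apply: ExWhileF; rewrite (bcompileE _ r); exact: H0.
have [hb /(_ m r)[m1 [t1 [s1 [ex1 le1 r1 I1]]]]] := Hs k s Is.
have [m2 [t2 [s2 [ex2 le2 r2 I2]]]] := IH s1 I1 m1 r1.
exists m2, (t1 + t2).+1, s2; split=> //; last lia.
by apply: ExWhileT ex1 ex2; rewrite (bcompileE _ r).
Qed.

(** A round costs the body, the increment and the test, hence [T.+2]; the outer [.+2] pays for the
    initialization and the failing test. *)
Lemma run_for (Inv : nat -> state -> Prop) A e c s T k (Q : state -> Prop) :
  Inv 0 (set s A 0 0) ->
  (forall i s', i <= k -> Inv i s' -> hev s' e = k) ->
  (forall i s', i < k -> Inv i s' -> s' A 0 = i ->
     run c s' T (fun s2 => s2 A 0 = i /\ Inv i.+1 (set s2 A 0 i.+1))) ->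
  (forall s', Inv k s' -> Q s') ->
  run (For A e c) s (k * T.+2).+2 Q.
Proof.
move=> H0 He Hc HQ; rewrite -[(k * _).+2]/(1 + (k * _).+1); apply: run_seq.
apply: run_put => /=.
pose J r s' := exists i, [/\ i + r = k, Inv i s' & s' A 0 = i].
apply: (@run_imp (J 0)); last by move=> s' [i [+ Ii _]]; rewrite addn0 => ik; apply: HQ; rewrite -ik.
apply: (@run_while J).
- move=> r s' [i [ir Ii Ai]]; split; first by rewrite /= (He i) //; lia.
  rewrite -[T.+1]addn1; apply: run_seq.
  apply: run_imp (Hc i s' _ Ii Ai) _; first lia.
  move=> s2 [Ai2 Ii2]; apply: run_put => /=; rewrite Ai2 addn1.
  by exists i.+1; split=> //; [lia|rewrite /set !eqxx].
- by move=> s' [i [ir Ii Ai]]; rewrite /= (He i) //; lia.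
- by exists 0; split=> //; rewrite /set !eqxx.
Qed.

End Runs.

Definition frame (W : arr -> bool) (s s' : state) : Prop :=
  forall A, ~~ W A -> s' A =1 s A.

Lemma frame_set (W : arr -> bool) s s' A i v : W A -> frame W s s' -> frame W s (set s' A i v).
Proof.
move=> WA F B WB j; rewrite -F // /set; case: eqP => //= /arr_id_inj eBA.
by rewrite eBA WA in WB.
Qed.

Lemma frame_trans (V W : arr -> bool) s1 s2 s3 :
  (forall A, V A -> W A) -> frame W s1 s2 -> frame V s2 s3 -> frame W s1 s3.
Proof.
move=> VW F12 F23 A WA j; rewrite F23 ?F12 //; exact: contra (VW A) WA.
Qed.

(** * Breadth-first search *)

Definition push : cmd :=
  aRES.@(!vI) ::= 1 ;; aQU.@(!vTL) ::= !vI ;; !vTL ::= !vTL + 1.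

Definition rk_self : hexp := (aRK.@(aOFF.@(!vSO + !vI) + !vI))%prog.
Definition rk_of (A : arr) : hexp := (aRK.@(aOFF.@(!vSO + !vI) + !A))%prog.
Definition is_cand (A : arr) : hbexp :=
  (aRK.@(aOFF.@(!vOO + !A) + !vI) <? aRK.@(aOFF.@(!vOO + !A) + !A))%prog.
Definition unmodified (A B : arr) : hbexp := (aMD.@(!A + !B) =? 0)%prog.

(** The minimum starts at n, which exceeds every rank, so a final value n means that no unmodified
    candidate exists and the node is a sink. *)
Definition scan : cmd :=
  !vFP ::= !vN ;;
  For vK (!vN)
    (If (unmodified vOO vK &? is_cand vK &? (rk_of vK <? !vFP)) (!vFP ::= rk_of vK) CSkip) ;;
  aFST.@(!vI) ::= !vFP ;;
  If (!vFP =? !vN) push (aRES.@(!vI) ::= 0).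

Definition edge_test : hbexp :=
  ((~? unmodified vSO vI &? (aGS.@(!vSO + !vI) =? !vJ) &?
      ((unmodified vOO vJ &? is_cand vJ) |?
       (~? unmodified vOO vJ &? ~? (!vJ =? !vI) &? ~? (aGS.@(!vOO + !vJ) =? !vI))))
   |? (unmodified vSO vI &? (rk_self <? rk_of vJ) &? ~? (aFST.@(!vI) <? rk_of vJ) &?
       (~? unmodified vOO vJ |? is_cand vJ)))%prog.

(** Edges are followed backwards, from a queued j to every i with an admissible edge to j. The loop
    visits n queue positions and skips those past the tail; once the tail is reached nothing more is
    pushed. *)
Definition search : cmd :=
  For vK (!vN)
    (If (!vK <? !vTL)
       (!vJ ::= aQU.@(!vK) ;;
        For vI (!vN) (If ((aRES.@(!vI) =? 0) &? edge_test) push CSkip))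
       CSkip).

Definition check : cmd :=
  !vTL ::= 0 ;; For vI (!vN) scan ;; search ;; If (!vTL <? !vN) (!vOK ::= 0) CSkip.

(* Agents are numbered a < n + n: the men first, then n + j for the woman mu j.
   The offsets so and oo, one of which is 0 and the other one n, select the side
   whose successors are searched and the opposite side. *)
Section Check.
Variables (P : nat) (low : memory).
Local Notation run := (run P low).
Variables (n : nat) (R : nat -> nat -> nat).

Record tables (s : state) : Prop := Tables {
  tab_n : s vN 0 = n;
  tab_off : forall a, a < n + n -> s aOFF a = a * n;
  tab_rk : forall a j, a < n + n -> j < n -> s aRK (a * n + j) = R a j }.

Definition table_arr (A : arr) : bool :=
  match A with vN | aOFF | aRK => true | _ => false end.

Lemma tables_frame (W : arr -> bool) s s' : (forall A, table_arr A -> ~~ W A) ->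
  frame W s s' -> tables s -> tables s'.
Proof. by move=> WA F [h1 h2 h3]; split=> *; rewrite F ?WA //; auto. Qed.

Variables (md g : nat -> nat) (so oo : nat).

Definition cand_n i k := R (oo + k) i < R (oo + k) k.

Definition fixed_n i k := (md (oo + k) == 0) && cand_n i k.

Fixpoint first_fixed i k : nat :=
  if k is k'.+1 then
    if fixed_n i k' && (R (so + i) k' < first_fixed i k') then R (so + i) k'
    else first_fixed i k'
  else n.

Definition sink_n i := first_fixed i n == n.

Definition opt_n i j : bool :=
  if md (so + i) != 0 then
    (g (so + i) == j) && (if md (oo + j) != 0 then (j != i) && (g (oo + j) != i) else cand_n i j)
  else [&& R (so + i) i < R (so + i) j, R (so + i) j <= first_fixed i n
         & (md (oo + j) != 0) || cand_n i j].

(** [grounded] and [trapped] are the certificates of success and of failure that a search yields: a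
    rank decreasing towards the sinks, or a nonempty closed set without sinks. *)
Definition grounded : Prop := exists rho : nat -> nat, forall i, i < n ->
  sink_n i \/ exists j, [/\ j < n, opt_n i j & rho j < rho i].

Definition trapped : Prop := exists D : pred nat,
  (exists2 i, i < n & D i) /\
  forall i, i < n -> D i -> ~~ sink_n i /\ forall j, j < n -> opt_n i j -> D j.

Lemma first_fixedP i k x :
  x <= first_fixed i k <-> x <= n /\ forall k', k' < k -> fixed_n i k' -> x <= R (so + i) k'.
Proof.
elim: k => [|k IH] /=; first by split=> [|[]].
case: ifP => h; last first.
  rewrite IH; split=> [[xn H]|[xn H]]; split=> // k' k'k; last by apply: H; lia.
  have [->|k'k2 F] := eqVneq k' k; last by apply: H => //; lia.
  move=> F; move: h; rewrite F /= => /negbT; rewrite -leqNgt; apply: leq_trans.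
  by apply/IH.
case/andP: h => F lt; split=> [le|[xn H]]; last exact: H.
have /IH[xn H] := ltnW (leq_ltn_trans le lt); split=> // k'.
by rewrite ltnS leq_eqVlt => /orP[/eqP ->|/H].
Qed.

Definition bfs_writes (A : arr) : bool :=
  match A with vTL | vI | vK | vJ | vFP | aFST | aRES | aQU => true | _ => false end.

Record env (s : state) : Prop := Env {
  env_tab : tables s; env_so : s vSO 0 = so; env_oo : s vOO 0 = oo;
  env_md : forall a, a < n + n -> s aMD a = md a;
  env_g : forall a, a < n + n -> s aGS a = g a }.

Lemma env_frame s s' : frame bfs_writes s s' -> env s -> env s'.
Proof.
move=> F [h1 h2 h3 h4 h5]; split; try by move=> *; rewrite F //; auto.
by apply: tables_frame F h1; case.
Qed.

Hypotheses (so_le : so <= n) (oo_le : oo <= n).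

Lemma idx_so i : i < n -> so + i < n + n. Proof. by move=> ?; lia. Qed.
Lemma idx_oo i : i < n -> oo + i < n + n. Proof. by move=> ?; lia. Qed.

Lemma run_scan s i (Q : state -> Prop) T : env s -> i < n -> s vI 0 = i ->
  (forall s', frame bfs_writes s s' -> s' vI 0 = i -> s' vTL 0 = s vTL 0 ->
     s' aRES =1 s aRES -> s' aQU =1 s aQU ->
     (forall x, s' aFST x = if x == i then first_fixed i n else s aFST x) ->
     s' vFP 0 = first_fixed i n -> s' vN 0 = n ->
     run (If (!vFP =? !vN) push (aRES.@(!vI) ::= 0)) s' T Q) ->
  run scan s (5 * n + 4 + T) Q.
Proof.
move=> Es iN Ei H.
pose W A := match A with vFP | vK => true | _ => false end.
pose Inv k s' := frame W s s' /\ s' vFP 0 = first_fixed i k.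
have -> : 5 * n + 4 + T = 1 + ((n * 5).+2 + (1 + T)) by lia.
apply: run_seq; apply: run_put => /=; apply: run_seq.
have FW s' : frame W s s' -> frame bfs_writes s s' by move=> F A /= WA; apply: F; case: A WA.
apply: (@run_for _ _ Inv _ _ _ _ 3 n) => /=.
- by split; [do !apply: frame_set|rewrite /= (tab_n (env_tab Es))].
- by move=> k s' _ [F _]; rewrite F // (tab_n (env_tab Es)).
- move=> k s' kn [F Ef] Ek.
  have [[En Eoff Erk] Eso Eoo Emd Eg] := env_frame (FW _ F) Es.
  have Ei' : s' vI 0 = i by rewrite F.
  have test : hbev s' (unmodified vOO vK &? is_cand vK &? (rk_of vK <? !vFP)) =
      fixed_n i k && (R (so + i) k < first_fixed i k).
    rewrite /= Eso Eoo Ek Ei' Emd ?idx_oo // !Eoff ?idx_so ?idx_oo //.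
    by rewrite !Erk ?idx_so ?idx_oo // Ef andbA.
  apply: (@run_if _ _ _ _ _ _ 1 1) => b; [apply: run_put|apply: run_skip]; split=> //=.
  + split; first by do !apply: frame_set.
    rewrite /= -test b Eso Ei' Ek Eoff ?idx_so // Erk ?idx_so //.
  + split; first by do !apply: frame_set.
    by rewrite /= -test (negPf b).
- move=> s' [F Ef]; apply: run_seq; apply: run_put => /=; apply: H.
  + by apply: frame_set => //; exact: (FW _ F).
  + by rewrite /set /= F.
  + by rewrite /set /= F.
  + by move=> x; rewrite /set /= F.
  + by move=> x; rewrite /set /= F.
  + by move=> x; rewrite /set /= (F vI) // (F aFST) // Ei Ef.
  + by rewrite /set /= Ef.
  + by rewrite /set /= F // (tab_n (env_tab Es)).
Qed.

(** By [queue_ord], each entry that is not a sink has an admissible edge to an earlier one, so the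
    position in the queue serves as the rank in [grounded]. *)
Record queue (q : seq nat) (tl : nat) (qu : nat -> nat) : Prop := Queue {
  queue_tl : tl = size q;
  queue_nth : forall k, k < size q -> qu k = nth 0 q k;
  queue_uniq : uniq q;
  queue_lt : forall x, x \in q -> x < n;
  queue_ord : forall k, k < size q -> sink_n (nth 0 q k) \/
    exists2 k', k' < k & opt_n (nth 0 q k) (nth 0 q k') }.

Lemma queue_push q tl qu i : queue q tl qu -> i < n -> i \notin q ->
  (sink_n i \/ exists2 j, j \in q & opt_n i j) ->
  queue (rcons q i) (tl + 1) (fun k => if k == tl then i else qu k).
Proof.
case=> -> Hnth Hu Hlt Hord iN iq Hi; split.
- by rewrite size_rcons addn1.
- move=> k; rewrite size_rcons ltnS nth_rcons leq_eqVlt => /orP[/eqP ->|kq].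
    by rewrite ltnn eqxx.
  by rewrite kq ltn_eqF // Hnth.
- by rewrite rcons_uniq iq.
- by move=> x; rewrite mem_rcons inE => /orP[/eqP ->|/Hlt].
- move=> k; rewrite size_rcons ltnS leq_eqVlt => /orP[/eqP ->|kq].
    rewrite nth_rcons ltnn eqxx; case: Hi => [|[j jq oij]]; [by left|right].
    exists (index j q); first by rewrite index_mem.
    by rewrite nth_rcons index_mem jq nth_index.
  rewrite nth_rcons kq; case: (Hord k kq) => [|[k' k'k o]]; [by left|right].
  by exists k' => //; rewrite nth_rcons (ltn_trans k'k kq).
Qed.

Lemma queue_size q tl qu : queue q tl qu -> size q <= n.
Proof.
case=> _ _ Hu Hlt _; rewrite -[X in _ <= X](size_iota 0); apply: uniq_leq_size => //.
by move=> x /Hlt xn; rewrite mem_iota.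
Qed.

Lemma queue_ext q tl qu tl' qu' : tl' = tl -> qu' =1 qu -> queue q tl qu -> queue q tl' qu'.
Proof. by move=> -> E [h1 h2 *]; split=> // k kq; rewrite E h2. Qed.

Lemma ltn_S x i : (x < i.+1) = (x == i) || (x < i).
Proof. by rewrite ltnS leq_eqVlt. Qed.

Definition scanned s i s' := frame bfs_writes s s' /\
  exists q, [/\ queue q (s' vTL 0) (s' aQU),
    forall x, x \in q = (x < i) && sink_n x,
    forall x, x < i -> s' aRES x = (x \in q)
  & forall x, x < i -> s' aFST x = first_fixed x n].

Lemma run_scan_all s : env s ->
  run (For vI (!vN) scan) (set s vTL 0 0) (n * (5 * n + 11)).+2 (scanned s n).
Proof.
move=> Es; apply: (@run_le _ _ (n * (5 * n + 9).+2).+2); last by lia.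
apply: (@run_for _ _ (scanned s) _ _ _ _ (5 * n + 9) n) => //.
- split; first by do !apply: frame_set.
  by exists [::]; split=> //; split.
- by move=> i s' _ [F _]; rewrite /= (tab_n (env_tab (env_frame F Es))).
- move=> i s' iN [F [q [Q Hq Hres Hfst]]] Ei.
  apply: (@run_le _ _ (5 * n + 4 + 5)); last by lia.
  apply: (run_scan (env_frame F Es) iN Ei) => s2 F2 Ei2 Etl Eres Equ Efst Efp En.
  have F3 : frame bfs_writes s s2 by apply: frame_trans F F2.
  have Q2 : queue q (s2 vTL 0) (s2 aQU) by exact: queue_ext Q.
  have iq : i \notin q by rewrite Hq ltnn.
  apply: (@run_if _ _ _ _ _ _ 3 1) => /=; rewrite Efp En -/(sink_n i) => si.
    apply: (@run_seq _ _ _ _ _ 1 2); apply: run_put => /=.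
    apply: (@run_seq _ _ _ _ _ 1 1); apply: run_put => /=; apply: run_put => /=.
    split=> //; split; first by do !apply: frame_set.
    exists (rcons q i); split.
    + rewrite /set /= Ei2; apply: queue_ext (queue_push Q2 iN iq (or_introl si)) => //.
    + by move=> x; rewrite mem_rcons inE Hq ltn_S; case: eqP => [->|//]; rewrite si.
    + move=> x; rewrite ltn_S mem_rcons inE /set /= Ei2 Eres.
      by case: eqP => //= _ xi; rewrite Hres.
    + move=> x; rewrite ltn_S /set /= Efst.
      by case: eqP => [->|] //= _ xi; rewrite Hfst.
  apply: run_put => /=; split=> //; split; first by do !apply: frame_set.
  exists q; split=> //.
  + by move=> x; rewrite Hq ltn_S; case: eqP => [->|//]; rewrite (negPf si) ltnn.
  + move=> x; rewrite ltn_S /set /= Ei2 Eres.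
    by case: eqP => [-> _|//= _ xi]; [rewrite (negPf iq)|rewrite Hres].
  + move=> x; rewrite ltn_S /set /= Efst.
    by case: eqP => [->|] //= _ xi; rewrite Hfst.
Qed.

Lemma edge_testE s i j : env s -> i < n -> j < n -> s vI 0 = i -> s vJ 0 = j ->
  s aFST i = first_fixed i n -> hbev s edge_test = opt_n i j.
Proof.
move=> [[En Eoff Erk] Eso Eoo Emd Eg] iN jN Ei Ej Ef.
rewrite /= Eso Eoo Ei Ej Ef !Emd ?idx_so ?idx_oo // !Eoff ?idx_so ?idx_oo //.
rewrite !Erk ?idx_so ?idx_oo // !Eg ?idx_so ?idx_oo // /opt_n -/(cand_n i j).
rewrite -leqNgt; case: (md (so + i) == 0); case: (md (oo + j) == 0) => /=;
  case: (cand_n i j); rewrite ?andbT ?andbF ?orbF ?negbK //=.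
Qed.

Definition searched s k s' := frame bfs_writes s s' /\
  exists q, [/\ queue q (s' vTL 0) (s' aQU),
    forall x, x < n -> sink_n x -> x \in q,
    forall x, x < n -> s' aRES x = (x \in q),
    forall x, x < n -> s' aFST x = first_fixed x n
  & forall k' x, k' < k -> k' < size q -> x < n -> opt_n x (nth 0 q k') -> x \in q].

Lemma run_search s s' : env s -> searched s 0 s' ->
  run search s' (n * (7 * n + 7)).+2 (searched s n).
Proof.
move=> Es S0; apply: (@run_le _ _ (n * (7 * n + 5).+2).+2); last by lia.
apply: (@run_for _ _ (searched s) _ _ _ _ (7 * n + 5) n) => //.
- case: S0 => F [q [Q h1 h2 h3 h4]].
  by split; [do !apply: frame_set|exists q].
- by move=> k s1 _ [F _]; rewrite /= (tab_n (env_tab (env_frame F Es))).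
move=> k s1 kn [F1 [q [Q Hs Hres Hfst Hcl]]] Ek.
have Etl := queue_tl Q.
apply: (@run_le _ _ ((1 + (n * 5.+2).+2) + 1).+1); last by lia.
apply: run_if => /=; rewrite Ek Etl; last first.
  rewrite -leqNgt => qk; apply: run_skip; split=> //; split; first by do !apply: frame_set.
  exists q; split=> // k' x k'k k'q; apply: Hcl => //; lia.
move=> kq; apply: run_seq; apply: run_put => /=; rewrite Ek.
set j := nth 0 q k; have jN : j < n by apply: (queue_lt Q); rewrite mem_nth.
rewrite (queue_nth Q) // -/j.
(* In the last clause, the positions before k are fully explored, while position k itself is
   explored only for the nodes below i. *)
pose Inv i s2 := [/\ frame bfs_writes s s2, s2 vK 0 = k, s2 vJ 0 = j &
  exists q, [/\ queue q (s2 vTL 0) (s2 aQU),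
    k < size q /\ nth 0 q k = j,
    forall x, x < n -> sink_n x -> x \in q,
    (forall x, x < n -> s2 aRES x = (x \in q)) /\
    (forall x, x < n -> s2 aFST x = first_fixed x n)
  & forall k' x, k' < k.+1 -> k' < size q -> x < n -> (k' == k) ==> (x < i) ->
      opt_n x (nth 0 q k') -> x \in q]].
apply: (@run_for _ _ Inv _ _ _ _ 5 n).
- split=> //; first by do !apply: frame_set.
  exists q; split=> // k' x; rewrite ltn_S => /orP[/eqP ->|k'k]; first by rewrite eqxx.
  by move=> k'q xN _; exact: Hcl.
- by move=> i s2 _ [F _ _ _]; rewrite /= (tab_n (env_tab (env_frame F Es))).
- move=> i s2 iN [F2 Ek2 Ej2 [q2 [Q2 [kq2 nthk] Hs2 [Hres2 Hfst2] Hcl2]]] Ei2.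
  have test := edge_testE (env_frame F2 Es) iN jN Ei2 Ej2 (Hfst2 i iN).
  have bE : hbev s2 ((aRES.@(!vI) =? 0) &? edge_test) = (i \notin q2) && opt_n i j.
    by rewrite -test /= Ei2 Hres2 // eqb0.
  apply: (@run_if _ _ _ _ _ _ 3 1); rewrite bE.
    move=> /andP[iq oij].
    apply: (@run_seq _ _ _ _ _ 1 2); apply: run_put => /=.
    apply: (@run_seq _ _ _ _ _ 1 1); apply: run_put => /=; apply: run_put => /=.
    split=> //; split=> //; first by do !apply: frame_set.
    exists (rcons q2 i); rewrite size_rcons nth_rcons kq2.
    have sub x : x \in q2 -> x \in rcons q2 i by rewrite mem_rcons inE orbC => ->.
    split; [|split=> //; lia| | |].
    + apply: queue_ext (queue_push Q2 iN iq _) => //.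
        by move=> x; rewrite /set /= Ei2.
      by right; exists j => //; rewrite -nthk mem_nth.
    + by move=> x xN /Hs2 - /(_ xN); exact: sub.
    + split=> x xN; last by rewrite /set /= Hfst2.
      rewrite /set /= Ei2 mem_rcons inE Hres2 //.
      by case: eqP.
    + move=> k' x k'k _ xN imp.
      have k'q : k' < size q2 by lia.
      rewrite nth_rcons k'q => o; have [->|xi] := eqVneq x i; first by rewrite mem_rcons inE eqxx.
      apply: sub; apply: Hcl2 o => //; apply/implyP=> /(implyP imp).
      by rewrite ltn_S (negPf xi).
  rewrite negb_and negbK => nq; apply: run_skip; split=> //; split=> //.
    by do !apply: frame_set.
  exists q2; split=> // k' x k'k k'q xN imp o.
  have [e|xi] := eqVneq x i.
    have [ek'|k'ne] := eqVneq k' k; last by apply: Hcl2 o => //; rewrite (negPf k'ne).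
    by move: nq; rewrite e => /orP[//|]; rewrite -nthk -ek' -e o.
  apply: Hcl2 o => //; apply/implyP=> /(implyP imp).
  by rewrite ltn_S (negPf xi).
- move=> s2 [F2 Ek2 Ej2 [q2 [Q2 [kq2 nthk] Hs2 [Hres2 Hfst2] Hcl2]]].
  split; first by rewrite Ek2.
  split; first by do !apply: frame_set.
  exists q2; split=> // k' x k'k k'q xN; apply: Hcl2 => //.
  by rewrite xN implybT.
Qed.

Definition check_writes (A : arr) : bool :=
  match A with vOK => true | _ => bfs_writes A end.

(** If the queue fills up to n nodes, positions in it show [grounded]; otherwise its complement is
    [trapped]. *)
Lemma run_check s : env s ->
  run check s (12 * (n * n) + 18 * n + 8)
    (fun s' => frame check_writes s s' /\
       (s' vOK 0 = s vOK 0 /\ grounded \/ s' vOK 0 = 0 /\ trapped)).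
Proof.
move=> Es.
apply: (@run_le _ _ (1 + ((n * (5 * n + 11)).+2 + ((n * (7 * n + 7)).+2 + (1 + 1).+1)))); last by lia.
apply: run_seq; apply: run_put => /=; apply: run_seq.
apply: run_imp (run_scan_all Es) _ => s1 [F1 [q1 [Q1 Hq1 Hres1 Hfst1]]].
apply: run_seq.
have S0 : searched s 0 s1.
  by split=> //; exists q1; split=> // x xN sx; rewrite Hq1 xN.
apply: run_imp (run_search Es S0) _ => s2 [F2 [q [Q Hs Hres Hfst Hcl]]].
have F3 : frame check_writes s s2 by move=> A /= WA; apply: F2; case: A WA.
have qn := queue_size Q.
apply: run_if => /=; rewrite (queue_tl Q) (tab_n (env_tab (env_frame F2 Es))) => qlt.
  apply: run_put => /=; split; first by apply: frame_set.
  right; split=> //; exists [pred x | x \notin q]; split.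
    have [/hasP[x]|/hasPn none] := boolP (has [pred x | x \notin q] (iota 0 n)).
      by rewrite mem_iota => /andP[_ xn] xq; exists x.
    suff : n <= size q by rewrite leqNgt qlt.
    rewrite -[X in X <= _](size_iota 0); apply: uniq_leq_size; first exact: iota_uniq.
    by move=> x /none /=; rewrite negbK.
  move=> i iN /= iq; split; first by apply: contra iq; exact: Hs.
  move=> j jN o; apply: contra iq => jq.
  apply: (Hcl (index j q) i) => //; rewrite ?index_mem ?nth_index //.
  by apply: leq_trans qn; rewrite index_mem.
apply: run_skip; split=> //; left; split; first by rewrite F2.
exists (fun x => index x q) => i iN.
have iq : i \in q.
  have [//|iq] := boolP (i \in q).
  suff : size (i :: q) <= n by rewrite /= ltnNge; lia.
  rewrite -[X in _ <= X](size_iota 0); apply: uniq_leq_size; first by rewrite /= iq (queue_uniq Q).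
  by move=> x; rewrite inE mem_iota => /orP[/eqP ->|/(queue_lt Q)] //.
have := queue_ord Q; rewrite -index_mem in iq => /(_ _ iq).
rewrite nth_index -?index_mem //; case=> [|[k' k'k o]]; [by left|right].
have k'q : k' < size q := ltn_trans k'k iq.
exists (nth 0 q k'); split=> //; first by apply: (queue_lt Q); rewrite mem_nth.
by rewrite index_uniq // (queue_uniq Q).
Qed.

End Check.

(** * Enumeration of the guesses *)

Section Enumeration.
Variables (n l : nat).
Hypothesis n_gt0 : 0 < n.

(** A digit encodes one of the 2n agents together with one of n successors, so the numerals with l
    digits are exactly the vectors of l guesses. *)
Definition base := (n + n) * n.
Definition digit V t := V %/ base ^ t %% base.
Definition agent V t := digit V t %/ n.
Definition guess V t := digit V t %% n.

Fixpoint marks V k a : nat :=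
  if k is k'.+1 then if a == agent V k' then 1 else marks V k' a else 0.

(** When an agent occurs in several digits the last one wins, as in the loop of [decode]. *)
Fixpoint guesses V k a : nat :=
  if k is k'.+1 then if a == agent V k' then guess V k' else guesses V k' a else 0.

Lemma base_gt0 : 0 < base.
Proof. by rewrite muln_gt0 addn_gt0 n_gt0. Qed.

Lemma digit_lt V t : digit V t < base.
Proof. by rewrite ltn_pmod // base_gt0. Qed.

(** Counting up by one changes digit t exactly when all lower digits wrap to zero, that is, when
    [base ^ t] divides [V.+1]. *)
Lemma digitS V t :
  digit V.+1 t = if base ^ t %| V.+1 then (if (digit V t).+1 < base then (digit V t).+1 else 0)
                 else digit V t.
Proof.
rewrite /digit divnS ?expn_gt0 ?base_gt0 //; case: ifP => _ //; rewrite add1n.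
set q := V %/ _; have := ltn_pmod q base_gt0; rewrite -[in LHS]addn1 -modnDml addn1.
by rewrite leq_eqVlt => /orP[/eqP e|lt]; [rewrite e modnn ltnn|rewrite lt modn_small].
Qed.

Lemma carryS V t : base ^ t.+1 %| V.+1 = (base ^ t %| V.+1) && ~~ ((digit V t).+1 < base).
Proof.
have [d|nd] := boolP (base ^ t %| V.+1); last first.
  by apply: contraNF nd; apply: dvdn_trans; rewrite expnS dvdn_mull.
have -> : base ^ t.+1 %| V.+1 = (digit V.+1 t == 0).
  rewrite expnSr /digit -{1}(divnK d) -/(dvdn _ _) mulnC dvdn_pmul2r ?expn_gt0 ?base_gt0 //.
by rewrite digitS d /=; case: ifP.
Qed.

Lemma digits_surj (f : nat -> nat) k : (forall t, t < k -> f t < base) ->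
  exists2 V, V < base ^ k & forall t, t < k -> digit V t = f t.
Proof.
elim: k => [|k IH] Hf; first by exists 0.
have [|V Vlt VE] := IH; first by move=> t tk; apply: Hf; lia.
exists (f k * base ^ k + V).
  rewrite expnS; have := Hf k (ltnSn k); nia.
move=> t; rewrite ltnS leq_eqVlt => /orP[/eqP ->|tk].
  rewrite /digit divnMDl ?expn_gt0 ?base_gt0 // (divn_small Vlt) addn0.
  by rewrite modn_small ?Hf.
have -> : base ^ k = base ^ (k - t.+1) * base * base ^ t.
  by rewrite -mulnA -expnS -expnD subnK.
rewrite -(VE t tk) /digit (mulnA (f k)) (mulnA (f k) _ base).
by rewrite divnMDl ?expn_gt0 ?base_gt0 // modnMDl.
Qed.

Lemma marksP V k a : reflect (exists2 t, t < k & agent V t = a) (marks V k a != 0).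
Proof.
apply: (iffP idP).
  elim: k => [//|k IH] /=; case: (a =P agent V k) => [-> _|_ /IH[t tk e]]; first by exists k.
  by exists t => //; exact: leqW.
move=> [t + <-]; elim: k => //= k IH; rewrite ltnS leq_eqVlt => /orP[/eqP ->|/IH].
  by rewrite eqxx.
by case: ifP.
Qed.

Lemma guessesE V k (h : nat -> nat) a : (forall t, t < k -> guess V t = h (agent V t)) ->
  marks V k a != 0 -> guesses V k a = h a.
Proof.
elim: k => //= k IH H; case: (a =P agent V k) => [-> _|_]; first by rewrite H.
by apply: IH => t tk; apply: H; exact: leqW.
Qed.

Lemma marked_card V :
  #|[set a : 'I_(n + n) | marks V l a != 0]| <= l.
Proof.
rewrite -[X in _ <= X](size_iota 0) -(size_map (agent V)) cardE -(size_map val).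
apply: uniq_leq_size; first by rewrite map_inj_uniq ?enum_uniq //; exact: val_inj.
move=> _ /mapP[a + ->]; rewrite mem_enum inE => /marksP[t tl e]; rewrite /= -e.
by apply: map_f; rewrite mem_iota.
Qed.

End Enumeration.

(** * From numeric tables to rank functions on ordinals *)

Section Bridge.
Variables (n : nat) (R : nat -> nat -> nat) (md g : nat -> nat) (so oo : nat).
Variables (a b : 'I_n -> 'I_n -> nat).
Hypotheses (aE : forall i j : 'I_n, R (so + i) j = a i j)
           (bE : forall i j : 'I_n, R (oo + i) j = b i j).
Hypothesis a_lt : forall i j, a i j < n.

Local Notation X := (fun i : 'I_n => md (so + i) != 0).
Local Notation Y := (fun i : 'I_n => md (oo + i) != 0).
Local Notation gU := (fun i : 'I_n => g (so + i)).
Local Notation gW := (fun i : 'I_n => g (oo + i)).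

Lemma fixed_nE (i k : 'I_n) : fixed_n R md oo i k = ~~ Y k && (b k i < b k k).
Proof. by rewrite /fixed_n /cand_n !bE negbK. Qed.

Lemma first_fixed_geE (i : 'I_n) x : x <= n ->
  (x <= first_fixed n R md so oo i n) =
  [forall k, ~~ Y k && (b k i < b k k) ==> (x <= a i k)].
Proof.
move=> xn; apply/idP/forallP => [/first_fixedP[_ H] k|H].
  by apply/implyP; rewrite -fixed_nE -aE; exact: H.
apply/first_fixedP; split=> // k kn.
by have /implyP := H (Ordinal kn); rewrite -fixed_nE -aE.
Qed.

Lemma sink_nE (i : 'I_n) : sink_n n R md so oo i = sink b Y i.
Proof.
have le : first_fixed n R md so oo i n <= n.
  by have /first_fixedP[] := leqnn (first_fixed n R md so oo i n).
rewrite /sink_n eqn_leq le first_fixed_geE //; apply: eq_forallb => k.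
rewrite [n <= _]leqNgt a_lt implybF negb_and negbK.
by case: (md _ != 0).
Qed.

Lemma opt_nE (i j : 'I_n) : opt_n n R md g so oo i j = opt a b X Y gU gW i j.
Proof.
rewrite /opt_n /opt /cand_n !aE !bE first_fixed_geE //; exact: ltnW.
Qed.

Lemma grounded_rho : grounded n R md g so oo ->
  exists rho : 'I_n -> nat, forall i,
    sink b Y i \/ exists2 j, opt a b X Y gU gW i j & rho j < rho i.
Proof.
case=> rho H; exists rho => i; case: (H i (ltn_ord i)) => [s|[j [jn o lt]]].
  by left; rewrite -sink_nE.
by right; exists (Ordinal jn) => //; rewrite -opt_nE.
Qed.

Lemma trapped_unresolved : trapped n R md g so oo ->
  exists2 D, D != set0 & unresolved (sink b Y) (opt a b X Y gU gW) D.
Proof.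
case=> D [[i iN Di] H]; exists [set i : 'I_n | D i].
  by apply/set0Pn; exists (Ordinal iN); rewrite inE.
move=> k; rewrite inE => Dk; have [s o] := H k (ltn_ord k) Dk.
split; first by rewrite -sink_nE.
by move=> j; rewrite inE -opt_nE; exact: o.
Qed.

End Bridge.

(** * Correctness of the enumeration *)

Section Decision.
Variables (n : nat) (S : SMinst n) (mu : {perm 'I_n}) (l : nat) (R : nat -> nat -> nat).
Hypothesis n_gt0 : 0 < n.
Hypotheses (R_U : forall i j : 'I_n, R i j = rkU mu S i j)
           (R_W : forall i j : 'I_n, R (n + i) j = rkW mu S i j).

Definition accepts V :=
  grounded n R (marks n V l) (guesses n V l) 0 n /\
  grounded n R (marks n V l) (guesses n V l) n 0.

Definition rejects V :=
  trapped n R (marks n V l) (guesses n V l) 0 n \/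
  trapped n R (marks n V l) (guesses n V l) n 0.

Let ltU i j : rkU mu S i j < n. Proof. exact: ltn_ord. Qed.
Let ltW i j : rkW mu S i j < n. Proof. exact: ltn_ord. Qed.

Lemma accepts_EUR V : accepts V -> EUR S mu l.
Proof.
set md := marks n V l; set g := guesses n V l.
case=> /(grounded_rho (a := rkU mu S) (b := rkW mu S) R_U R_W ltU)[rU HU].
move=> /(grounded_rho (a := rkW mu S) (b := rkU mu S) R_W R_U ltW)[rW HW].
apply: (EUR_sound _ HU HW).
apply: leq_trans (@marked_card n l V); rewrite -!sum1_card big_split_ord /=.
by apply: leq_add; apply: eq_leq; apply: eq_bigl => i; rewrite inE.
Qed.

(** Since every tried guess turns out accepted or rejected, this and [accepts_EUR] decide the
    problem. *)
Lemma EUR_not_rejects : EUR S mu l -> exists2 V, V < base n ^ l & ~ rejects V.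
Proof.
move=> /EUR_complete[X [Y [hU [hW [cardl H]]]]].
pose h a := if insub a is Some i then val (hU i)
            else if insub (a - n) is Some j then val (hW j) else 0.
have hUE (i : 'I_n) : h i = hU i by rewrite /h valK.
have hWE (j : 'I_n) : h (n + j) = hW j.
  by rewrite /h insubN ?addKn ?valK // -leqNgt leq_addr.
have h_lt a : h a < n.
  by rewrite /h; case: insubP => [*|_]; rewrite ?ltn_ord //; case: insubP => [*|_]; rewrite ?ltn_ord.
pose ags := [seq val i | i <- enum X] ++ [seq n + val j | j <- enum Y].
have ags_size : size ags <= l by rewrite size_cat !size_map -!cardE.
have ags_lt a : a \in ags -> a < n + n.
  by rewrite mem_cat => /orP[] /mapP[i _ ->] /=; have := ltn_ord i; lia.
(* Past the end of [ags] the padding agent is 0. Marking it is harmless because [EUR_complete]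
   covers supersets and its guess is [h 0] as well. *)
pose ag t := nth 0 ags t.
have ag_lt t : ag t < n + n.
  rewrite /ag; have [tl|tl] := ltnP t (size ags); first by apply: ags_lt; rewrite mem_nth.
  by rewrite nth_default // addn_gt0 n_gt0.
have [t tl|V Vlt VE] := @digits_surj n n_gt0 (fun t => ag t * n + h (ag t)) l.
  apply: leq_trans (leq_mul (ag_lt t) (leqnn n)).
  by rewrite mulSn [n + _]addnC ltn_add2l h_lt.
have agE t : t < l -> agent n V t = ag t.
  by move=> tl; rewrite /agent VE // divnMDl // divn_small ?addn0.
have guE t : t < l -> guess n V t = h (agent n V t).
  by move=> tl; rewrite agE // /guess VE // modnMDl modn_small.
have mdP a : a \in ags -> marks n V l a != 0.
  move=> aI; apply/marksP; exists (index a ags).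
    by apply: leq_trans ags_size; rewrite index_mem.
  by rewrite agE ?/ag ?nth_index //; apply: leq_trans ags_size; rewrite index_mem.
exists V => //.
have [||||HU HW] := H [pred i : 'I_n | marks n V l (0 + i) != 0]
    [pred j : 'I_n | marks n V l (n + j) != 0]
    (fun i => guesses n V l (0 + i)) (fun j => guesses n V l (n + j)).
- by move=> i iX; rewrite inE; apply: mdP; rewrite mem_cat; apply/orP; left; apply: map_f; rewrite mem_enum.
- by move=> j jY; rewrite inE; apply: mdP; rewrite mem_cat; apply/orP; right; apply: (map_f (fun j : 'I_n => n + val j)); rewrite mem_enum.
- by move=> i mi; rewrite (guessesE guE mi) -hUE.
- by move=> j mj; rewrite (guessesE guE mj) hWE.
case=> [/(trapped_unresolved (a := rkU mu S) (b := rkW mu S) R_U R_W ltU)[D Dn0 un]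
       |/(trapped_unresolved (a := rkW mu S) (b := rkU mu S) R_W R_U ltW)[D Dn0 un]].
  by move: Dn0; rewrite (HU D un) eqxx.
by move: Dn0; rewrite (HW D un) eqxx.
Qed.

End Decision.

(** * Trying one guess and moving to the next *)

Definition decode : cmd :=
  For vI (!vNN) (aMD.@(!vI) ::= 0 ;; aGS.@(!vI) ::= 0) ;;
  For vI (!vL) (!vX ::= aDG.@(!vI) ;; aMD.@(aTA.@(!vX)) ::= 1 ;;
                aGS.@(aTA.@(!vX)) ::= aTG.@(!vX)).

(** An odometer in which [vDONE] is the carry: it starts at 1, and if it is still 1 after the last
    digit the counter has overflowed and all guesses have been tried. *)
Definition advance : cmd :=
  !vDONE ::= 1 ;;
  For vI (!vL)
    (If (!vDONE =? 1)
       (If (aDG.@(!vI) + 1 <? !vMM) (aDG.@(!vI) ::= aDG.@(!vI) + 1 ;; !vDONE ::= 0)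
          (aDG.@(!vI) ::= 0))
       CSkip).

Definition try : cmd :=
  decode ;; !vOK ::= 1 ;;
  !vSO ::= 0 ;; !vOO ::= !vN ;; check ;;
  !vSO ::= !vN ;; !vOO ::= 0 ;; check ;;
  If (!vOK =? 1) (!vFOUND ::= 1) CSkip ;; advance.

Definition try_all : cmd := While (!vDONE =? 0) try.

Section TryAll.
Variables (P : nat) (low : memory) (n l : nat) (R : nat -> nat -> nat).
Hypotheses (n_gt0 : 0 < n) (l_le : l <= n + n).
Local Notation run := (run P low).

Record ready (s : state) : Prop := Ready {
  ready_tab : tables n R s;
  ready_NN : s vNN 0 = n + n;
  ready_MM : s vMM 0 = base n;
  ready_L : s vL 0 = l;
  ready_TA : forall d, d < base n -> s aTA d = d %/ n;
  ready_TG : forall d, d < base n -> s aTG d = d %% n }.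

Definition try_writes (A : arr) : bool :=
  match A with
  | vN | vNN | vMM | vL | aOFF | aRK | aTA | aTG | aMI | aMU | vACC => false
  | _ => true end.

Lemma ready_frame s s' : frame try_writes s s' -> ready s -> ready s'.
Proof.
move=> F [h1 h2 h3 h4 h5 h6]; split; try by move=> *; rewrite F //; auto.
by apply: tables_frame F h1; case.
Qed.

Definition decode_writes (A : arr) : bool :=
  match A with vI | vX | aMD | aGS => true | _ => false end.

Lemma run_decode s V : ready s -> (forall t, t < l -> s aDG t = digit n V t) ->
  run decode s ((n + n) * 9 + 4)
    (fun s' => frame decode_writes s s' /\
       forall a, a < n + n -> s' aMD a = marks n V l a /\ s' aGS a = guesses n V l a).
Proof.
move=> Rs Hd; apply: (@run_le _ _ (((n + n) * 4).+2 + (l * 5).+2)); last by lia.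
have F2 s' : frame decode_writes s s' -> frame try_writes s s'.
  by move=> F A WA; apply: F; case: A WA.
apply: run_seq.
pose Inv0 i s' := frame decode_writes s s' /\
  forall a, a < i -> s' aMD a = 0 /\ s' aGS a = 0.
apply: (@run_for _ _ Inv0 _ _ _ _ 2 (n + n)).
- by split=> //; do !apply: frame_set.
- by move=> i s' _ [F _]; rewrite /= (ready_NN (ready_frame (F2 _ F) Rs)).
- move=> i s' iN [F H] Ei; apply: (@run_seq _ _ _ _ _ 1 1); do 2!apply: run_put => /=.
  split=> //; split; first by do !apply: frame_set.
  move=> a; rewrite ltn_S /set /= Ei; case: eqP => //= _ ai.
  exact: H.
- move=> s1 [F1 H1].
  pose Inv k s' := frame decode_writes s s' /\
    forall a, a < n + n -> s' aMD a = marks n V k a /\ s' aGS a = guesses n V k a.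
  apply: (@run_for _ _ Inv _ _ _ _ 3 l) => //.
  + split; first by do !apply: frame_set.
    by move=> a /H1 [E1 E2]; rewrite /set /= E1 E2.
  + by move=> i s' _ [F _]; rewrite /= (ready_L (ready_frame (F2 _ F) Rs)).
  + move=> k s' kl [F H] Ek; have Rs' := ready_frame (F2 _ F) Rs.
    apply: (@run_seq _ _ _ _ _ 1 2); apply: run_put => /=.
    apply: (@run_seq _ _ _ _ _ 1 1); do 2!apply: run_put => /=.
    split=> //; split; first by do !apply: frame_set.
    move=> a aN; have Edg : s' aDG k = digit n V k by rewrite F // Hd.
    rewrite /set /= Ek Edg !(ready_TA Rs') ?digit_lt // !(ready_TG Rs') ?digit_lt //.
    by have [E1 E2] := H a aN; rewrite E1 E2.
Qed.

Definition advance_writes (A : arr) : bool :=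
  match A with vI | vDONE | aDG => true | _ => false end.

Lemma run_advance s V : ready s -> (forall t, t < l -> s aDG t = digit n V t) ->
  run advance s ((n + n) * 10 + 3)
    (fun s' => [/\ frame advance_writes s s', s' vDONE 0 = (base n ^ l %| V.+1)
       & forall t, t < l -> s' aDG t = digit n V.+1 t]).
Proof.
move=> Rs Hd; apply: (@run_le _ _ (1 + (l * 8).+2)); last by lia.
have F2 s' : frame advance_writes s s' -> frame try_writes s s'.
  by move=> F A WA; apply: F; case: A WA.
apply: run_seq; apply: run_put => /=.
pose Inv i s' := [/\ frame advance_writes s s', s' vDONE 0 = (base n ^ i %| V.+1),
  forall t, t < i -> s' aDG t = digit n V.+1 t
  & forall t, i <= t < l -> s' aDG t = digit n V t].
apply: (@run_for _ _ Inv _ _ _ _ 6 l).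
- split=> //; first by do !apply: frame_set.
  by rewrite expn0 dvd1n.
- by move=> i s' _ [F _ _ _]; rewrite /= (ready_L (ready_frame (F2 _ F) Rs)).
- move=> i s' il [F Ed H1 H2] Ei.
  have Edg : s' aDG i = digit n V i by rewrite H2 // leqnn.
  apply: (@run_if _ _ _ _ _ _ 4 1) => /=; rewrite Ed eqb1 => c.
    apply: (@run_if _ _ _ _ _ _ 2 1) => /=.
      rewrite Ei Edg (ready_MM (ready_frame (F2 _ F) Rs)) addn1 => lt.
      apply: (@run_seq _ _ _ _ _ 1 1); do 2!apply: run_put => /=; rewrite Ei Edg.
      split=> //; split; first by do !apply: frame_set.
      - by rewrite /set /= carryS // c lt.
      - move=> t; rewrite ltn_S /set /=; case: eqP => [-> _|_ /H1 //].
        by rewrite digitS // c lt addn1.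
      - move=> t it; rewrite /set /= gtn_eqF; last by case/andP: it.
        by apply: H2; lia.
    rewrite Ei Edg (ready_MM (ready_frame (F2 _ F) Rs)) addn1 => lt.
    apply: run_put => /=; rewrite Ei.
    split=> //; split; first by do !apply: frame_set.
    - by rewrite /set /= Ed carryS // c lt.
    - move=> t; rewrite ltn_S /set /=; case: eqP => [-> _|_ /H1 //].
      by rewrite digitS // c (negPf lt).
    - move=> t it; rewrite /set /= gtn_eqF; last by case/andP: it.
      by apply: H2; lia.
  apply: run_skip; split=> //; split; first by do !apply: frame_set.
  - by rewrite /set /= Ed carryS // (negPf c).
  - move=> t; rewrite ltn_S /set /=; case: eqP => [-> _|_ /H1 //].
    by rewrite digitS // (negPf c).
  - by move=> t it; rewrite /set /=; apply: H2; lia.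
- by move=> s' [F E H _].
Qed.

Local Notation accepts := (accepts n l R).
Local Notation rejects := (rejects n l R).

Definition found_upto V s :=
  s vFOUND 0 = 1 /\ (exists V', accepts V') \/
  s vFOUND 0 = 0 /\ forall V', V' < V -> rejects V'.

Definition try_inv k s := exists V, [/\ V + k = base n ^ l, ready s,
  s vDONE 0 = (k == 0), k != 0 -> forall t, t < l -> s aDG t = digit n V t
  & found_upto V s].

Lemma run_try s k : try_inv k.+1 s -> run try s (24 * (n * n) + 74 * n + 34) (try_inv k).
Proof.
case=> V [Vk Rs Ed Hd Hf]; have {}Hd := Hd isT.
pose tc := 12 * (n * n) + 18 * n + 8.
apply: (@run_le _ _ (((n + n) * 9 + 4) + (1 + (1 + (1 + (tc + (1 + (1 + (tc +
   ((1 + 1).+1 + ((n + n) * 10 + 3))))))))))); last by rewrite /tc; lia.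
apply: run_seq; apply: run_imp (run_decode Rs Hd) _ => s1 [F1 H1].
have F1' : frame try_writes s s1 by move=> A WA; apply: F1; case: A WA.
do 3!(apply: run_seq; apply: run_put => /=); apply: run_seq.
set s2 := set _ vOO _ _.
have F2 : frame try_writes s s2 by do !apply: frame_set.
have Rs2 := ready_frame F2 Rs.
have env2 : env n R (marks n V l) (guesses n V l) 0 n s2.
  split; rewrite ?(ready_tab Rs2) //.
  - exact: ready_tab Rs2.
  - by rewrite /s2 /set /= F1 // (tab_n (ready_tab Rs)).
  - by move=> a /H1[].
  - by move=> a /H1[].
apply: run_imp (run_check (leq0n n) (leqnn n) env2) _ => s3 [F3 Hc3].
do 2!(apply: run_seq; apply: run_put => /=); apply: run_seq.
set s4 := set _ vOO _ _.
have F3' : frame try_writes s s3 by apply: frame_trans F2 F3; case.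
have F4 : frame try_writes s s4 by do !apply: frame_set.
have Rs4 := ready_frame F4 Rs.
have env4 : env n R (marks n V l) (guesses n V l) n 0 s4.
  split.
  - exact: ready_tab Rs4.
  - by rewrite /s4 /set /= F3' // (tab_n (ready_tab Rs)).
  - by [].
  - by move=> a /H1[E _]; rewrite /s4 /set /= F3 // /s2 /set /= E.
  - by move=> a /H1[_ E]; rewrite /s4 /set /= F3 // /s2 /set /= E.
apply: run_imp (run_check (leqnn n) (leq0n n) env4) _ => s5 [F5 Hc5].
have F5' : frame try_writes s s5 by apply: frame_trans F4 F5; case.
have Hd5 t : t < l -> s5 aDG t = digit n V t.
  by move=> tl; rewrite F5 // /s4 /set /= F3 // /s2 /set /= F1 // Hd.
have Efound : s5 vFOUND 0 = s vFOUND 0.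
  by rewrite F5 // /s4 /set /= F3 // /s2 /set /= F1.
have Hok : s5 vOK 0 = 1 /\ accepts V \/ s5 vOK 0 = 0 /\ rejects V.
  have E4 : s4 vOK 0 = s3 vOK 0 by [].
  have E2 : s2 vOK 0 = 1 by [].
  rewrite E4 in Hc5; rewrite E2 in Hc3.
  case: Hc5 => -[-> H5]; last by right; split=> //; right.
  by case: Hc3 => -[-> H3]; [left|right; split=> //; left].
apply: run_seq.
have step s6 : frame try_writes s s6 -> s6 aDG =1 s5 aDG -> found_upto V.+1 s6 ->
    run advance s6 ((n + n) * 10 + 3) (try_inv k).
  move=> F6 Ed6 Hf6; have Rs6 := ready_frame F6 Rs.
  have Hd6 t : t < l -> s6 aDG t = digit n V t by move=> tl; rewrite Ed6 Hd5.
  apply: run_imp (run_advance Rs6 Hd6) _ => s7 [F7 E7 H7].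
  have F7' : frame try_writes s s7 by apply: frame_trans F6 F7; case.
  exists V.+1; split; first by rewrite addSnnS.
  - exact: ready_frame F7' Rs.
  (* [V.+1] is positive and at most [base n ^ l], so divisibility means equality, that is, k = 0. *)
  - rewrite E7; congr nat_of_bool; have -> : base n ^ l = V.+1 + k by lia.
    case: (posnP k) => [->|k_gt0]; first by rewrite addn0 dvdnn.
    by rewrite gtnNdvd ?gtn_eqF //; lia.
  - by move=> _.
  - by rewrite /found_upto F7.
apply: run_if => /=.
  move/eqP=> ok; apply: run_put => /=; apply: step => //; first by do !apply: frame_set.
  by left; split=> //; exists V; case: Hok => -[] //; rewrite ok.
move=> nok; apply: run_skip; apply: step => //; rewrite /found_upto Efound.
case: Hf => [Hf|[Ef Hf]]; [by left|right; split=> // V'; rewrite ltn_S].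
case/orP=> [/eqP ->|]; last exact: Hf.
by case: Hok => -[] // ok; rewrite ok in nok.
Qed.

Lemma run_try_all s : ready s -> s vDONE 0 = 0 -> s vFOUND 0 = 0 ->
  (forall t, s aDG t = 0) ->
  run try_all s (base n ^ l * (24 * (n * n) + 74 * n + 35)).+1
    (fun s' => s' vFOUND 0 = 1 /\ (exists V, accepts V) \/
               s' vFOUND 0 = 0 /\ forall V, V < base n ^ l -> rejects V).
Proof.
move=> Rs Ed Ef Hdg; rewrite -[35]addn1 addnA addn1.
have H0 : try_inv (base n ^ l) s.
  exists 0; split=> //; last by right.
    by rewrite Ed eqn0Ngt expn_gt0 base_gt0.
  by move=> _ t _; rewrite Hdg /digit div0n mod0n.
apply: run_imp (@run_while _ _ try_inv _ _ _ _ _ _ _ H0) _.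
- move=> k s' I; split; last exact: run_try.
  by case: I => V [_ _ E _ _]; rewrite /= E.
- by move=> s' [V [_ _ E _ _]]; rewrite /= E.
- by move=> s' [V [+ _ _ _ H]]; rewrite addn0 => <-.
Qed.

End TryAll.

(** * Reading the input *)

(** Lacking multiplication, the machine accumulates the multiples of n in [vACC], which ends at
    [base n]. Cell 1 now holds the base address [P]; subtraction recovers l from it. *)
Definition load_sizes : cmd :=
  Read (!vN)%prog 0 ;; !vNN ::= !vN + !vN ;;
  For vI (!vNN) (aOFF.@(!vI) ::= !vACC ;; !vACC ::= !vACC + !vN) ;;
  !vMM ::= !vACC ;;
  Read (!vL)%prog 1 ;; !vL ::= !vL - (!vMM + !vN + 3) ;;
  If (!vNN <? !vL) (!vL ::= !vNN) CSkip.

Definition load_matching : cmd :=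
  For vI (!vN) (Read (!vX)%prog (!vMM + 2 + !vI)%prog ;; aMU.@(!vI) ::= !vX ;; aMI.@(!vX) ::= !vI).

(** A woman is renamed after her partner: here [aMI] translates the column, and in [load_women]
    [aMU] selects the input row. *)
Definition load_men : cmd :=
  For vI (!vN) (For vK (!vN)
    (Read (!vX)%prog (aOFF.@(!vI) + 2 + !vK)%prog ;;
     aRK.@(aOFF.@(!vI) + aMI.@(!vX)) ::= !vK)).

Definition load_women : cmd :=
  For vI (!vN) (For vK (!vN)
    (Read (!vX)%prog (aOFF.@(!vN + aMU.@(!vI)) + 2 + !vK)%prog ;;
     aRK.@(aOFF.@(!vN + !vI) + !vX) ::= !vK)).

(** These tables of quotients and remainders by n replace the missing division when digits are
    decoded. *)
Definition fill_digit_tables : cmd :=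
  For vI (!vNN) (For vK (!vN)
    (aTA.@(aOFF.@(!vI) + !vK) ::= !vI ;; aTG.@(aOFF.@(!vI) + !vK) ::= !vK)).

Definition setup : cmd :=
  load_sizes ;; load_matching ;; load_men ;; load_women ;; fill_digit_tables.

Lemma index_inj n i x i' x' : x < n -> x' < n -> i * n + x = i' * n + x' -> i = i' /\ x = x'.
Proof.
move=> xn xn' e; have n_gt0 : 0 < n by exact: leq_ltn_trans xn.
split.
  by have := congr1 (divn^~ n) e; rewrite /= !divnMDl // !divn_small // !addn0.
by have := congr1 (modn^~ n) e; rewrite /= !modnMDl !modn_small.
Qed.

Section Setup.
Variables (n : nat) (S : SMinst n) (mu : {perm 'I_n}) (l P : nat) (low : memory).
Hypothesis n_gt0 : 0 < n.
Hypothesis P_def : P = l + (base n + n + 3).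
Hypotheses (low0 : low 0 = n) (low1 : low 1 = P).
Hypothesis low_U : forall i k : 'I_n, low (i * n + 2 + k) = prefU S i k.
Hypothesis low_W : forall j k : 'I_n, low ((n + j) * n + 2 + k) = prefW S j k.
Hypothesis low_mu : forall i : 'I_n, low (base n + 2 + i) = mu i.
Local Notation run := (run P low).

Definition rank_table (a j : nat) : nat :=
  if insub j is Some j' then
    if insub a is Some i then rkU mu S i j'
    else if insub (a - n) is Some i then rkW mu S i j' else 0
  else 0.

Lemma rank_tableU (i j : 'I_n) : rank_table i j = rkU mu S i j.
Proof. by rewrite /rank_table !valK. Qed.

Lemma rank_tableW (i j : 'I_n) : rank_table (n + i) j = rkW mu S i j.
Proof.
by rewrite /rank_table valK insubN ?addKn ?valK // -leqNgt leq_addr.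
Qed.

Lemma rank_table_lt a j : rank_table a j < n.
Proof.
rewrite /rank_table; case: insub => [j'|//]; case: insub => [i|]; first exact: ltn_ord.
by case: insub => [i|//]; exact: ltn_ord.
Qed.

Lemma rank_table_inj a : a < n + n -> {in gtn n &, injective (rank_table a)}.
Proof.
move=> aN j j' jn j'n; rewrite -[j]/(val (Ordinal jn)) -[j']/(val (Ordinal j'n)).
have [an|an] := ltnP a n.
  by rewrite -[a]/(val (Ordinal an)) !rank_tableU => /rkU_inj ->.
have an' : a - n < n by lia.
by rewrite -(subnKC an) -[a - n]/(val (Ordinal an')) !rank_tableW => /rkW_inj ->.
Qed.

Definition sizes s := [/\ s vN 0 = n, s vNN 0 = n + n, s vMM 0 = base n,
  s vL 0 = minn l (n + n) & forall a, a < n + n -> s aOFF a = a * n].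

Definition sizes_writes (A : arr) : bool :=
  match A with vN | vNN | vMM | vL | vI | vACC | aOFF => true | _ => false end.

Lemma sizes_frame (W : arr -> bool) s s' :
  ~~ [|| W vN, W vNN, W vMM, W vL | W aOFF] -> frame W s s' -> sizes s -> sizes s'.
Proof.
rewrite !negb_or => /and5P[w1 w2 w3 w4 w5] F [h1 h2 h3 h4 h5].
by split; try (move=> a ?); rewrite F //; exact: h5.
Qed.

Let s0 : state := fun _ _ => 0.

Lemma run_load_sizes : run load_sizes s0 ((n + n) * 4 + 11)
  (fun s => frame sizes_writes s0 s /\ sizes s).
Proof.
apply: (@run_le _ _ (1 + (1 + (((n + n) * 4).+2 + (1 + (1 + (1 + (1 + 1).+1))))))); last lia.
apply: run_seq; apply: run_read; first by rewrite /= P_def; lia.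
apply: run_seq; apply: run_put; rewrite /= low0; apply: run_seq.
set s1 := set _ vNN _ _.
pose Inv i s := [/\ frame sizes_writes s0 s, s vN 0 = n, s vNN 0 = n + n,
  s vACC 0 = i * n & forall a, a < i -> s aOFF a = a * n].
apply: (@run_for _ _ Inv _ _ _ _ 2 (n + n)).
- by split=> //; do !apply: frame_set.
- by move=> i s _ [].
- move=> i s iN [F En ENN Ea Eo] Ei.
  apply: (@run_seq _ _ _ _ _ 1 1); do 2!apply: run_put => /=.
  split=> //; split=> //; first by do !apply: frame_set.
    by rewrite /set /= Ea En mulSn addnC.
  by move=> a; rewrite ltn_S /set /= Ei; case: eqP => [-> _|_ /Eo].
move=> s [F En ENN Ea Eo].
apply: run_seq; apply: run_put => /=; rewrite Ea -/(base n).
apply: run_seq; apply: run_read; first by rewrite /= P_def; lia.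
rewrite [hev _ _]/= low1; apply: run_seq; apply: run_put => /=.
set s2 := set _ vL 0 _.
have E2 : s2 vL 0 = l by rewrite /s2 /set /= En P_def addnK.
have EN2 : s2 vNN 0 = n + n by rewrite /s2 /set /= ENN.
have F2 : frame sizes_writes s0 s2 by do !apply: frame_set.
apply: run_if => /=; rewrite E2 EN2 => lt.
  apply: run_put => /=; split; first by do !apply: frame_set.
  by split=> //; rewrite /set /= EN2; apply/esym/minn_idPr; exact: ltnW.
apply: run_skip; split=> //; split=> //; rewrite E2.
by apply/esym/minn_idPl; rewrite leqNgt.
Qed.

Lemma cell_lt a k : a < n + n -> k < n -> a * n + k < base n.
Proof.
move=> aN kn; apply: leq_trans (leq_mul aN (leqnn n)).
by rewrite mulSn [n + _]addnC ltn_add2l.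
Qed.

Definition matching_writes (A : arr) : bool :=
  match A with vI | vX | aMU | aMI => true | _ => false end.

Definition matching_loaded (s : state) :=
  forall i : 'I_n, s aMU i = mu i /\ s aMI (mu i) = i.

Lemma run_load_matching s : sizes s ->
  run load_matching s (n * 5 + 2)
    (fun s' => frame matching_writes s s' /\ matching_loaded s').
Proof.
move=> Zs; apply: (@run_le _ _ (n * 5).+2); last lia.
pose Inv i s' := frame matching_writes s s' /\
  forall j : 'I_n, j < i -> s' aMU j = mu j /\ s' aMI (mu j) = j.
apply: (@run_for _ _ Inv _ _ _ _ 3 n).
- by split=> //; do !apply: frame_set.
- by move=> i s' _ [F _]; have [En _ _ _ _] := sizes_frame (W := matching_writes) isT F Zs.
- move=> i s' iN [F H] Ei; have [En _ EM _ _] := sizes_frame (W := matching_writes) isT F Zs.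
  apply: (@run_seq _ _ _ _ _ 1 2); apply: run_read => /=; first by rewrite EM Ei P_def; lia.
  rewrite EM Ei (low_mu (Ordinal iN)).
  apply: (@run_seq _ _ _ _ _ 1 1); do 2!apply: run_put => /=.
  split=> //; split; first by do !apply: frame_set.
  move=> j; rewrite ltn_S /set /= Ei => ji.
  rewrite val_eqE (inj_eq perm_inj) -val_eqE /=.
  by case: eqP ji => [e _|_ /H //]; split=> //; congr (val (mu _)); exact: val_inj.
- by move=> s' [F H]; split=> // i; exact: H.
Qed.

(** A row is filled in order of preference, so the finished entries of row a are those of rank below
    k. *)
Definition rk_loaded a k (s : state) := forall a' j, j < n ->
  a' < a \/ a' = a /\ rank_table a' j < k -> s aRK (a' * n + j) = rank_table a' j.

Lemma rk_loaded_step a j0 k (s s' : state) : a < n + n -> j0 < n -> rank_table a j0 = k ->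
  rk_loaded a k s ->
  (forall x, s' aRK x = if x == a * n + j0 then k else s aRK x) -> rk_loaded a k.+1 s'.
Proof.
move=> aN j0n e H E a' j jn Hj; rewrite E; case: eqP => [/index_inj[]// -> ->//|ne].
apply: H => //; case: Hj => [|[ea lt]]; [by left|right; split=> //].
rewrite ltn_neqAle -ltnS lt andbT; apply/eqP=> rj.
by apply: ne; rewrite ea; congr (_ + _); apply: (rank_table_inj aN) => //; rewrite e -rj ea.
Qed.

Lemma rk_loaded_row a s : rk_loaded a n s -> rk_loaded a.+1 0 s.
Proof.
move=> H a' j jn [|[]//]; rewrite ltn_S => /orP[/eqP ->|lt]; apply: H => //; last by left.
by right; split=> //; exact: rank_table_lt.
Qed.

Lemma rankK (p : {perm 'I_n}) k : rank p (p k) = k.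
Proof. by rewrite /rank permK. Qed.

Definition fill_writes (A : arr) : bool :=
  match A with vI | vK | vX | aRK => true | _ => false end.

Lemma fill_frame s s' : frame fill_writes s s' -> sizes s -> matching_loaded s ->
  sizes s' /\ matching_loaded s'.
Proof.
move=> F Zs Ms; split; first exact: sizes_frame F Zs.
by move=> i; rewrite !F //; exact: Ms.
Qed.

Lemma run_load_men s : sizes s -> matching_loaded s ->
  run load_men s (n * (n * 4 + 4) + 2)
    (fun s' => frame fill_writes s s' /\ rk_loaded n 0 s').
Proof.
move=> Zs Ms; apply: (@run_le _ _ (n * (n * 4).+2.+2).+2); last lia.
pose Inv i s' := frame fill_writes s s' /\ rk_loaded i 0 s'.
apply: (@run_for _ _ Inv _ _ _ _ (n * 4).+2 n).
- by split=> [|a j _ [|[]]//]; do !apply: frame_set.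
- by move=> i s' _ [F _]; have [[En _ _ _ _] _] := fill_frame F Zs Ms.
- move=> i s1 iN [F1 H1] Ei1.
  pose Inv2 k s' := [/\ frame fill_writes s s', s' vI 0 = i & rk_loaded i k s'].
  apply: (@run_for _ _ Inv2 _ _ _ _ 2 n).
  + by split=> //; do !apply: frame_set.
  + by move=> k s' _ [F _ _]; have [[En _ _ _ _] _] := fill_frame F Zs Ms.
  + move=> k s' kn [F Ei H] Ek; have [[En _ EM _ Eo] M'] := fill_frame F Zs Ms.
    have iN2 : i < n + n by lia.
    have cl := cell_lt iN2 kn.
    apply: (@run_seq _ _ _ _ _ 1 1); apply: run_read => /=.
      by rewrite Ei Ek Eo // P_def; lia.
    rewrite Ei Ek Eo // (low_U (Ordinal iN) (Ordinal kn)).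
    set w := prefU S _ _; have [_ EMI] := M' (mu^-1 w)%g; rewrite permKV in EMI.
    set t := set s' vX 0 w.
    have [EtX EtI EtK EtO EtM] : [/\ t vX 0 = w, t vI 0 = i, t vK 0 = k, t aOFF i = i * n
        & t aMI w = (mu^-1 w)%g] by split=> //; exact: Eo.
    apply: run_put => /=; rewrite EtX EtI EtK EtO EtM.
    split=> //; split=> //; first by do !apply: frame_set.
    apply: (@rk_loaded_step _ (mu^-1 w)%g _ s') => //.
      by rewrite (rank_tableU (Ordinal iN)) /rkU permKV rankK.
  + move=> s' [F Ei H]; split=> //; split; first by do !apply: frame_set.
    exact: (rk_loaded_row H).
- by move=> s' [F H].
Qed.

Lemma run_load_women s : sizes s -> matching_loaded s -> rk_loaded n 0 s ->
  run load_women s (n * (n * 4 + 4) + 2)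
    (fun s' => frame fill_writes s s' /\ rk_loaded (n + n) 0 s').
Proof.
move=> Zs Ms H0; apply: (@run_le _ _ (n * (n * 4).+2.+2).+2); last lia.
pose Inv i s' := frame fill_writes s s' /\ rk_loaded (n + i) 0 s'.
apply: (@run_for _ _ Inv _ _ _ _ (n * 4).+2 n).
- by rewrite /Inv addn0; split=> //; do !apply: frame_set.
- by move=> i s' _ [F _]; have [[En _ _ _ _] _] := fill_frame F Zs Ms.
- move=> i s1 iN [F1 H1] Ei1.
  pose Inv2 k s' := [/\ frame fill_writes s s', s' vI 0 = i & rk_loaded (n + i) k s'].
  apply: (@run_for _ _ Inv2 _ _ _ _ 2 n).
  + by split=> //; do !apply: frame_set.
  + by move=> k s' _ [F _ _]; have [[En _ _ _ _] _] := fill_frame F Zs Ms.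
  + move=> k s' kn [F Ei H] Ek; have [[En _ EM _ Eo] M'] := fill_frame F Zs Ms.
    have iN2 : n + i < n + n by lia.
    have [EMU _] := M' (Ordinal iN); rewrite /= in EMU.
    have miN : n + mu (Ordinal iN) < n + n by rewrite ltn_add2l.
    have cl := cell_lt miN kn.
    apply: (@run_seq _ _ _ _ _ 1 1); apply: run_read => /=.
      by rewrite Ei Ek En EMU Eo // P_def; lia.
    rewrite Ei Ek En EMU Eo // (low_W (mu (Ordinal iN)) (Ordinal kn)).
    set w := prefW S _ _; set t := set s' vX 0 w.
    have [EtX EtI EtK EtN EtO] : [/\ t vX 0 = w, t vI 0 = i, t vK 0 = k, t vN 0 = n
        & t aOFF (n + i) = (n + i) * n] by split=> //; exact: Eo.
    apply: run_put => /=; rewrite EtX EtN EtI EtK EtO.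
    split=> //; split=> //; first by do !apply: frame_set.
    apply: (@rk_loaded_step _ (prefW S (mu (Ordinal iN)) (Ordinal kn)) _ s') => //.
      by rewrite (rank_tableW (Ordinal iN)) /rkW rankK.
  + move=> s' [F Ei H]; split=> //; split; first by do !apply: frame_set.
    by have := rk_loaded_row H; rewrite -addnS.
- by move=> s' [F H].
Qed.

Definition digits_writes (A : arr) : bool :=
  match A with vI | vK | aTA | aTG => true | _ => false end.

Lemma run_fill_digit_tables s : sizes s ->
  run fill_digit_tables s ((n + n) * (n * 4 + 4) + 2)
    (fun s' => frame digits_writes s s' /\
       forall d, d < base n -> s' aTA d = d %/ n /\ s' aTG d = d %% n).
Proof.
move=> Zs; apply: (@run_le _ _ ((n + n) * (n * 4).+2.+2).+2); last lia.
have fr s' : frame digits_writes s s' -> sizes s' by move=> F; exact: sizes_frame F Zs.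
pose good x (s' : state) := forall d, d < x -> s' aTA d = d %/ n /\ s' aTG d = d %% n.
pose Inv i s' := frame digits_writes s s' /\ good (i * n) s'.
apply: (@run_for _ _ Inv _ _ _ _ (n * 4).+2 (n + n)).
- by split=> //; do !apply: frame_set.
- by move=> i s' _ [F _]; have [_ ENN _ _ _] := fr _ F.
- move=> i s1 iN [F1 H1] Ei1.
  pose Inv2 k s' := [/\ frame digits_writes s s', s' vI 0 = i & good (i * n + k) s'].
  apply: (@run_for _ _ Inv2 _ _ _ _ 2 n).
  + by split=> //; [do !apply: frame_set|rewrite addn0].
  + by move=> k s' _ [F _ _]; have [En _ _ _ _] := fr _ F.
  + move=> k s' kn [F Ei H] Ek; have [En _ _ _ Eo] := fr _ F.
    apply: (@run_seq _ _ _ _ _ 1 1); do 2!apply: run_put => /=; rewrite Ei Ek Eo //.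
    split=> //; split=> //; first by do !apply: frame_set.
    move=> d; rewrite addnS ltn_S /set /= Ei Ek Eo //; case: eqP => [-> _|_ /H //].
    by rewrite divnMDl // divn_small // addn0 modnMDl modn_small.
  + move=> s' [F Ei H]; split=> //; split; first by do !apply: frame_set.
    by rewrite mulSn addnC.
- by move=> s' [F H].
Qed.

Lemma run_setup : run setup s0 (16 * (n * n) + 29 * n + 19)
  (fun s => [/\ ready n (minn l (n + n)) rank_table s, s vDONE 0 = 0, s vFOUND 0 = 0
    & forall t, s aDG t = 0]).
Proof.
apply: (@run_le _ _ (((n + n) * 4 + 11) + ((n * 5 + 2) + ((n * (n * 4 + 4) + 2) +
  ((n * (n * 4 + 4) + 2) + ((n + n) * (n * 4 + 4) + 2)))))); last lia.
apply: run_seq; apply: run_imp run_load_sizes _ => s1 [F1 Z1].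
apply: run_seq; apply: run_imp (run_load_matching Z1) _ => s2 [F2 M2].
have Z2 : sizes s2 by exact: sizes_frame F2 Z1.
apply: run_seq; apply: run_imp (run_load_men Z2 M2) _ => s3 [F3 H3].
have [Z3 M3] := fill_frame F3 Z2 M2.
apply: run_seq; apply: run_imp (run_load_women Z3 M3 H3) _ => s4 [F4 H4].
have [Z4 M4] := fill_frame F4 Z3 M3.
apply: run_imp (run_fill_digit_tables Z4) _ => s5 [F5 H5].
have Z5 : sizes s5 by exact: sizes_frame F5 Z4.
have zero A i : ~~ [|| sizes_writes A, matching_writes A, fill_writes A | digits_writes A] ->
    s5 A i = 0.
  by rewrite !negb_or => /and4P[*]; rewrite F5 // F4 // F3 // F2 // F1.
have [EN ENN EM EL EO] := Z5.
split; try by [rewrite zero|move=> t; rewrite zero].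
split=> //.
- by split=> // a j aN jn; rewrite F5 // H4 //; left.
- by move=> d /H5[].
- by move=> d /H5[].
Qed.

End Setup.

(** * Placing the arrays beyond the input *)

Local Notation cell k := (ALoad (ANum k)).
Local Notation "k <-- e" := (CStore (ANum k) e) (at level 80).

(* Cells 0 and 1 hold n and l, all the next ones hold data, and the first free
   address is not an offset that a single expression can compute.  Cell 2 is
   therefore borrowed as a loop counter: its content x < n is added to cell 3,
   whose content is y < n, in the form of y + n * x.  Cell 1 is then increased
   by 2 * n ^ 2 + n + 3, and the two data cells are restored. *)
Definition prelude : cmd :=
  CWhile (BLt (ANum 0) (cell 2)) (2 <-- ASub (cell 2) (ANum 1) ;; 3 <-- AAdd (cell 3) (cell 0)) ;;
  CWhile (BLt (cell 2) (cell 0)) (1 <-- AAdd (cell 1) (AAdd (cell 0) (cell 0)) ;; 2 <-- AAdd (cell 2) (ANum 1)) ;;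
  1 <-- AAdd (cell 1) (AAdd (cell 0) (ANum 3)) ;;
  2 <-- ANum 0 ;;
  CWhile (BNot (BLt (cell 3) (cell 0))) (3 <-- ASub (cell 3) (cell 0) ;; 2 <-- AAdd (cell 2) (ANum 1)).

Lemma exec_while (Inv : nat -> memory -> Prop) b c t :
  (forall k m, Inv k.+1 m -> beval m b /\ exists2 m', exec c m m' t & Inv k m') ->
  (forall m, Inv 0 m -> ~~ beval m b) ->
  forall k m, Inv k m -> exists2 m', exec (CWhile b c) m m' (k * t.+1).+1 & Inv 0 m'.
Proof.
move=> HS H0; elim=> [|k IH] m Im; first by exists m => //; apply/ExWhileF/H0.
have [hb [m1 ex1 /IH[m2 ex2 I2]]] := HS k m Im; exists m2 => //.
have -> : k.+1 * t.+1 = t + (k * t.+1).+1 by lia.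
exact: ExWhileT ex1 ex2.
Qed.

Lemma exec_store2 m a e b f :
  let m1 := upd m a (aeval m e) in
  exec (a <-- e ;; b <-- f) m (upd m1 b (aeval m1 f)) 2.
Proof. by apply: (@ExSeq _ _ _ _ _ 1 1); exact: ExStore. Qed.

(** As [y < n], repeated subtraction of n recovers x as the quotient and y as the remainder. The
    bound counts three loops of at most n rounds at cost 3, their failing tests and two stores. *)
Lemma exec_prelude n x y m : 0 < n -> x < n -> y < n -> m 0 = n -> m 2 = x -> m 3 = y ->
  exists m' t, [/\ exec prelude m m' t, t <= 9 * n + 5,
    m' 1 = m 1 + (n * (n + n) + (n + 3)) & forall a, a != 1 -> m' a = m a].
Proof.
move=> n_gt0 xn yn m0 mx my.
pose others m' := forall a, a \notin [:: 1; 2; 3] -> m' a = m a.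
pose Inv1 k m' := [/\ others m', m' 1 = m 1, m' 2 = k & m' 3 + n * k = y + n * x].
have [|||m1 ex1 [O1 e11 e12 e13]] := @exec_while Inv1 (BLt (ANum 0) (cell 2))
    (2 <-- ASub (cell 2) (ANum 1) ;; 3 <-- AAdd (cell 3) (cell 0)) 2 _ _ x m.
- move=> k m' [O e1 e2 e3]; split; first by rewrite /= e2.
  eexists; first exact: exec_store2.
  split; rewrite /upd /= ?e2 ?(O 0) // ?m0; last by rewrite mulnS in e3; lia.
    by move=> a ha; rewrite -(O a ha); move: ha; rewrite !inE !negb_or =>
      /and3P[/negPf h1 /negPf h2 /negPf h3]; rewrite ?h1 ?h2 ?h3.
  lia.
- by move=> m' [_ _ e _]; rewrite /= e.
- by split=> //; rewrite my.
pose Inv2 k m' := [/\ others m', m' 2 + k = n, m' 3 = y + n * x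
  & m' 1 + k * (n + n) = m 1 + n * (n + n)].
have [|||m2 ex2 [O2 e22 e23 e21]] := @exec_while Inv2 (BLt (cell 2) (cell 0))
    (1 <-- AAdd (cell 1) (AAdd (cell 0) (cell 0)) ;; 2 <-- AAdd (cell 2) (ANum 1)) 2 _ _ n m1.
- move=> k m' [O e2 e3 e1]; split; first by rewrite /= (O 0) // m0; lia.
  eexists; first exact: exec_store2.
  split; rewrite /upd /= ?(O 0) // ?m0; try lia.
  by move=> a ha; rewrite -(O a ha); move: ha; rewrite !inE !negb_or =>
      /and3P[/negPf h1 /negPf h2 /negPf h3]; rewrite ?h1 ?h2 ?h3.
- by move=> m' [O e _ _]; rewrite /= (O 0) // m0; lia.
- by split=> //; lia.
set m3 := upd m2 1 (m1 1 + 0 + (n * (n + n) + (n + 3))).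
have ex3 : exec (1 <-- AAdd (cell 1) (AAdd (cell 0) (ANum 3))) m2 m3 1.
  rewrite /m3; have -> : m1 1 + 0 + (n * (n + n) + (n + 3)) =
      aeval m2 (AAdd (cell 1) (AAdd (cell 0) (ANum 3))) by rewrite /= (O2 0) // m0; lia.
  exact: ExStore.
have ex4 : exec (2 <-- ANum 0) m3 (upd m3 2 0) 1 by exact: ExStore.
pose Inv3 k m' := [/\ others m', m' 1 = m 1 + (n * (n + n) + (n + 3)), m' 2 + k = x
  & m' 3 = y + n * k].
have [|||m5 ex5 [O5 e51 e52 e53]] := @exec_while Inv3 (BNot (BLt (cell 3) (cell 0)))
    (3 <-- ASub (cell 3) (cell 0) ;; 2 <-- AAdd (cell 2) (ANum 1)) 2 _ _ x (upd m3 2 0).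
- move=> k m' [O e1 e2 e3]; split; first by rewrite /= (O 0) // m0 e3 mulnS; lia.
  eexists; first exact: exec_store2.
  split; rewrite /upd /= ?(O 0) // ?m0 ?e3 ?mulnS; try lia.
  by move=> a ha; rewrite -(O a ha); move: ha; rewrite !inE !negb_or =>
      /and3P[/negPf h1 /negPf h2 /negPf h3]; rewrite ?h1 ?h2 ?h3.
- by move=> m' [O _ _ e]; rewrite /= (O 0) // m0 e; lia.
- split; rewrite /m3 /upd /= ?e11 ?e23 //; try lia.
  by move=> a ha; rewrite -(O2 a ha); move: ha; rewrite !inE !negb_or =>
      /and3P[/negPf h1 /negPf h2 /negPf h3]; rewrite ?h1 ?h2 ?h3.
exists m5; eexists; split.
- apply: ExSeq ex1 _; apply: ExSeq ex2 _; apply: ExSeq ex3 _; exact: ExSeq ex4 ex5.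
- lia.
- exact: e51.
move=> a a1; have [->|a2] := eqVneq a 2; first by rewrite mx; lia.
have [->|a3] := eqVneq a 3; first by rewrite my e53; lia.
by rewrite O5 // !inE !negb_or a1 a2.
Qed.

Definition decide_EUR : cmd :=
  CIf (BEq (cell 0) (ANum 0)) (0 <-- ANum 1)
    (prelude ;; setup ;; try_all ;; 0 <-- ALoad (address vFOUND (ANum 0))).

(** * Layout of the encoded input *)

Lemma nth_flatten_rows n (T : Type) (F : T -> seq nat) (rows : seq T) t0 i k :
  (forall t, size (F t) = n) -> i < size rows -> k < n ->
  nth 0 (flatten [seq F t | t <- rows]) (i * n + k) = nth 0 (F (nth t0 rows i)) k.
Proof.
move=> sF + kn; elim: rows i => [//|t rows IH] [|i] /= ir; rewrite nth_cat sF.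
  by rewrite mul0n add0n kn.
by rewrite mulSn -addnA ltnNge leq_addr /= addKn IH.
Qed.

Lemma nth_enum_map n (f : 'I_n -> nat) (i : 'I_n) : nth 0 [seq f k | k <- enum 'I_n] i = f i.
Proof. by rewrite (nth_map i) ?size_enum_ord // nth_ord_enum. Qed.

Section Encoding.
Variables (n : nat) (S : SMinst n) (mu : {perm 'I_n}) (l : nat).

Let row (p : 'I_n -> {perm 'I_n}) (i : 'I_n) := [seq val (p i k) | k <- enum 'I_n].
Let rows p := flatten [seq row p i | i <- enum 'I_n].

Let size_row p i : size (row p i) = n.
Proof. by rewrite size_map size_enum_ord. Qed.

Let size_rows p : size (rows p) = n * n.
Proof.
rewrite size_flatten /shape -map_comp (eq_map (g := fun=> n)) => [|i]; last exact: size_row.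
by rewrite sumnE big_map big_enum /= sum_nat_const card_ord.
Qed.

Let nth_rows p (i k : 'I_n) : nth 0 (rows p) (i * n + k) = p i k.
Proof.
rewrite (@nth_flatten_rows n _ _ _ i) ?size_enum_ord ?ltn_ord //.
by rewrite nth_ord_enum nth_enum_map.
Qed.

Lemma encodeU (i k : 'I_n) : encode S mu l (i * n + 2 + k) = prefU S i k.
Proof.
rewrite /encode /encode_seq addnAC addn2 /= nth_cat size_rows ifT.
  exact: nth_rows.
have := ltn_ord k; have := ltn_ord i; nia.
Qed.

Lemma encodeW (i k : 'I_n) : encode S mu l ((n + i) * n + 2 + k) = prefW S i k.
Proof.
rewrite /encode /encode_seq addnAC addn2 mulnDl -addnA /= nth_cat size_rows ifN ?addKn; last lia.
rewrite nth_cat size_rows ifT; first exact: nth_rows.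
have := ltn_ord k; have := ltn_ord i; nia.
Qed.

Lemma encode_mu (i : 'I_n) : encode S mu l (base n + 2 + i) = mu i.
Proof.
rewrite /encode /encode_seq addnAC addn2 /base mulnDl -addnA /= nth_cat size_rows ifN ?addKn; last lia.
rewrite nth_cat size_rows ifN ?addKn; last lia.
exact: (nth_enum_map (fun i => val (mu i))).
Qed.

Lemma encode_end a : base n + n + 2 <= a -> encode S mu l a = 0.
Proof.
move=> le; rewrite /encode nth_default // /encode_seq !size_cat size_map size_enum_ord.
by rewrite !size_rows /= /base in le *; lia.
Qed.

End Encoding.

(** * The empty instance, the time bound and the final assembly *)

Lemma EUR0 (S : SMinst 0) mu l : EUR S mu l.
Proof.
exists S; split; first by rewrite /num_reordered !eq_card0 // => -[].
apply/unique_stableE; split; first by case.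
- by move=> D _; apply/setP=> -[].
- by move=> D _; apply/setP=> -[].
Qed.

Lemma time_bound n l l' : 0 < n -> l' <= l ->
  1 + (9 * n + 5) + (16 * (n * n) + 29 * n + 19) +
    (base n ^ l' * (24 * (n * n) + 74 * n + 35)).+1 + 1
    <= 300 * (2 ^ l * n ^ (2 * l + 2) + 1).
Proof.
move=> n_gt0 le.
have -> : 2 ^ l * n ^ (2 * l + 2) = base n ^ l * (n * n).
  have -> : base n = 2 * n ^ 2 by rewrite /base addnn -mul2n -mulnA mulnn.
  by rewrite expnD mulnA expnM -expnMn mulnn.
have: base n ^ l' <= base n ^ l by rewrite leq_pexp2l ?base_gt0.
have: 0 < base n ^ l by rewrite expn_gt0 base_gt0.
move: (base n ^ l) (base n ^ l') => B B' B_gt0 leB.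
have nn : n <= n * n by rewrite leq_pmulr.
(* As n and 1 are at most [n * n], the three coefficients add up to 133. *)
have h1 : B' * (24 * (n * n) + 74 * n + 35) <= B * (133 * (n * n)).
  by apply: leq_mul => //; lia.
have h2 : n * n <= B * (n * n) by rewrite leq_pmull.
rewrite mulnCA in h1; lia.
Qed.

Theorem mainTheorem20 :
  exists (P : cmd) (C : nat),
    forall (n : nat) (I : SMinst n) (mu : {perm 'I_n}) (l : nat),
      exists (m' : memory) (t : nat),
        [/\ exec P (encode I mu l) m' t,
            t <= C * (2 ^ l * n ^ (2 * l + 2) + 1)
          & (m' 0 = 1 <-> EUR I mu l)].
Proof.
exists decide_EUR, 300 => n S mu l; set m := encode S mu l.
have [n0|n_gt0] := posnP n.
  subst n; exists (upd m 0 1), 2; split; last by split=> // _; exact: EUR0.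
    by apply: ExIfT => //; exact: ExStore.
  (* For n = 0 the power of n vanishes, and the summand 1 of the bound pays for the two steps. *)
  by rewrite mulnDr; lia.
pose P := l + (base n + n + 3).
have m2 : m 2 < n.
  have := ltn_ord (prefU S (Ordinal n_gt0) (Ordinal n_gt0)).
  by rewrite -(encodeU S mu l).
have m3 : m 3 < n.
  (* Cell 3 is the second entry of the first man's list, except for n = 1, where it is the only
     entry of the woman's list. *)
  have [n1|n1] := leqP n 1.
    have n1' : n = 1 by lia.
    have -> : 3 = (n + Ordinal n_gt0) * n + 2 + Ordinal n_gt0 by rewrite /=; nia.
    by rewrite /m encodeW ltn_ord.
  have := ltn_ord (prefU S (Ordinal n_gt0) (Ordinal n1)).
  by rewrite -(encodeU S mu l).
have [m1 [t1 [ex1 t1le m11 mE]]] := exec_prelude n_gt0 m2 m3 (erefl n : m 0 = n) erefl erefl.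
have P1 : m1 1 = P by rewrite m11 /P /base -[m 1]/l; lia.
have lowU (i k : 'I_n) : m1 (i * n + 2 + k) = prefU S i k.
  by rewrite mE; [exact: encodeU|lia].
have lowW (i k : 'I_n) : m1 ((n + i) * n + 2 + k) = prefW S i k.
  by rewrite mE; [exact: encodeW|lia].
have lowM (i : 'I_n) : m1 (base n + 2 + i) = mu i.
  by rewrite mE; [exact: encode_mu|lia].
have m10 : m1 0 = n by rewrite mE.
(* [P] lies past the end of the input, where the memory is zero, so all arrays start out zero. *)
have r1 : rep P m1 m1 (fun _ _ => 0).
  split=> // [|A i]; first by rewrite /P; lia.
  by rewrite mE; [apply: encode_end|]; rewrite /P; lia.
have [m4 [t2 [s2 [ex2 t2le r2 [R2 D2 F2 G2]]]]] :=
  run_setup n_gt0 erefl m10 P1 lowU lowW lowM r1.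
have [m5 [t3 [s3 [ex3 t3le r3 H3]]]] :=
  run_try_all n_gt0 (geq_minr l (n + n)) R2 D2 F2 G2 r2.
exists (upd m5 0 (s3 vFOUND 0)), (t1 + (t2 + (t3 + 1))).+1; split.
- apply: ExIfF; first by rewrite /= -lt0n.
  apply: ExSeq ex1 _; apply: ExSeq ex2 _; apply: ExSeq ex3 _.
  have -> : s3 vFOUND 0 = aeval m5 (ALoad (address vFOUND (ANum 0))).
    by rewrite (compileE (HGet vFOUND 0) r3).
  exact: ExStore.
- apply: leq_trans (time_bound n_gt0 (geq_minl l (n + n))); lia.
- rewrite /upd /= EUR_minn; case: H3 => [[-> [V acc]]|[-> rej]].
    split=> // _; exact: (accepts_EUR (R := rank_table S mu) (rank_tableU S mu) (rank_tableW S mu) acc).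
  split=> // /(EUR_not_rejects (R := rank_table S mu) n_gt0 (rank_tableU S mu) (rank_tableW S mu))[V Vlt].
  by case; exact: rej.
Qed.
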